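(* Let $V$ be a vector space over a field $\mathbf{k}$ of characteristic zero. Then the subspace $\mathsf{L}(V)\subset \mathsf{pL}(V)$ of Lie elements equals the kernel of the map $d:\mathsf{pL}(V)\to \mathsf{pL}^1(V)$: $$\mathsf{L}(V)=\mathrm{Ker}\left(d:\mathsf{pL}(V)\to\mathsf{pL}^1(V)\right).$$
   Context: A pre-Lie algebra is a vector space $X$ with a bilinear product $\star$ whose associator $\Phi(x,y,z):=(x\star y)\star z-x\star(y\star z)$ satisfies $\Phi(x,y,z)=\Phi(x,z,y)$. In a graded pre-Lie algebra the axiom is $\Phi(x,y,z)=(-1)^{|y||z|}\Phi(x,z,y)$. If $X$ is pre-Lie, $X_L$ denotes $X$ with the commutator bracket $[x,y]=x\star y-y\star x$; it is a Lie algebra. $\mathsf{pL}(V)$ is the free pre-Lie algebra generated by $V$, and $\mathsf{L}(V)\subset \mathsf{pL}(V)$ is the Lie subalgebra of $\mathsf{pL}(V)_L$ generated by $V$ (the subalgebra of Lie elements). $\mathsf{pL}^*(V,\circ)$ is the free graded pre-Lie algebra generated by $V$ (in degree $0$) and one extra ''dummy'' generator $\circ$ of degree $+1$. It is graded by the number of occurrences of $\circ$: $\mathsf{pL}^*(V,\circ)=\mathsf{pL}(V)\oplus\bigoplus_{n\ge1}\mathsf{pL}^n(V)$, where $\mathsf{pL}^n(V)$ is spanned by monomials with exactly $n$ occurrences of $\circ$. Let $\mathrm{r}\mathsf{pL}^*(V):=\mathsf{pL}^*(V,\circ)/(\circ\star\circ)$ be the quotient by the (two-sided) ideal generated by $\circ\star\circ$,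 with the induced grading; thus $\mathrm{r}\mathsf{pL}^0(V)=\mathsf{pL}(V)$ and $\mathrm{r}\mathsf{pL}^1(V)=\mathsf{pL}^1(V)$. The map $d:\mathrm{r}\mathsf{pL}^*(V)\to\mathrm{r}\mathsf{pL}^{*+1}(V)$ is the unique degree $+1$ linear map such that $d(v)=0$ for $v\in V$, $d(\circ)=0$ and $d(a\star b)=d(a)\star b+(-1)^{|a|}a\star d(b)+Q(a,b)$ for all $a,b\in \mathrm{r}\mathsf{pL}^*(V)$, where $Q(a,b):=(\circ\star a)\star b-\circ\star(a\star b)$. The map in the claim is its component from degree $0$ to degree $1$. *)

(* Defs.v *)
From HB Require Import structures.
From mathcomp Require Import all_boot all_order all_algebra.
From mathcomp Require Import boolp classical_sets.

Set Implicit Arguments.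
Unset Strict Implicit.
Unset Printing Implicit Defensive.

Import GRing.Theory.
Local Open Scope quotient_scope.
Local Open Scope classical_set_scope.
Local Open Scope ring_scope.

Section LinearProp.
Variables (k : fieldType) (U W : lmodType k) (f : U -> W).
Hypothesis f_lin : linear f.
Lemma lin0 : f 0 = 0.
Proof. by have := f_lin (-1) 0 0; rewrite scaler0 addr0 scaleN1r addNr. Qed.
Lemma linD x y : f (x + y) = f x + f y.
Proof. by rewrite -[x]scale1r f_lin !scale1r. Qed.
Lemma linZ c x : f (c *: x) = c *: f x.
Proof. by rewrite -[c *: x]addr0 f_lin lin0 addr0. Qed.
End LinearProp.

HB.mixin Record Lmodule_isNonAssocAlgebra (k : fieldType) A
    of GRing.Lmodule k A := {
  star : A -> A -> A;
  starDl : left_distributive star +%R;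
  starDr : right_distributive star +%R;
  starZl : forall (c : k) x y, star (c *: x) y = c *: star x y;
  starZr : forall (c : k) x y, star x (c *: y) = c *: star x y }.

#[short(type="naAlgType")]
HB.structure Definition NonAssocAlgebra (k : fieldType) :=
  {A of Lmodule_isNonAssocAlgebra k A & GRing.Lmodule k A}.

Notation "x ⋆ y" := (star x y) (at level 40, left associativity) : ring_scope.

Section NonAssoc.
Variables (k : fieldType) (A : naAlgType k).
Implicit Types (x y z : A) (S : set A).

Lemma star0l x : 0 ⋆ x = 0.
Proof. by rewrite -(scale0r (0 : A)) starZl !scale0r. Qed.
Lemma star0r x : x ⋆ 0 = 0.
Proof. by rewrite -(scale0r (0 : A)) starZr !scale0r. Qed.
Lemma starNl x y : (- x) ⋆ y = - (x ⋆ y).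
Proof. by rewrite -scaleN1r starZl scaleN1r. Qed.
Lemma starNr x y : x ⋆ (- y) = - (x ⋆ y).
Proof. by rewrite -scaleN1r starZr scaleN1r. Qed.
Lemma starBl x y z : (x - y) ⋆ z = x ⋆ z - y ⋆ z.
Proof. by rewrite starDl starNl. Qed.
Lemma starBr x y z : x ⋆ (y - z) = x ⋆ y - x ⋆ z.
Proof. by rewrite starDr starNr. Qed.
Lemma star_suml m (f : 'I_m -> A) y :
  (\sum_i f i) ⋆ y = \sum_i f i ⋆ y.
Proof.
elim: m f => [|m IH] f; first by rewrite !big_ord0 star0l.
by rewrite !big_ord_recl starDl IH.
Qed.

Definition associator x y z : A := (x ⋆ y) ⋆ z - x ⋆ (y ⋆ z).
Definition commutator x y : A := x ⋆ y - y ⋆ x.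

Definition pre_Lie : Prop :=
  forall x y z, associator x y z = associator x z y.

Definition submodule S : Prop :=
  S 0 /\ forall (c : k) x y, S x -> S y -> S (c *: x + y).

Definition Lie_subalgebra S : Prop :=
  submodule S /\ forall x y, S x -> S y -> S (commutator x y).

Definition two_sided_ideal S : Prop :=
  submodule S /\ forall x y, S x -> S (x ⋆ y) /\ S (y ⋆ x).

Definition Lie_generated S : set A := smallest Lie_subalgebra S.
Definition ideal_generated S : set A := smallest two_sided_ideal S.

Record graded_pre_Lie (hom : nat -> set A) : Prop := GradedPreLie {
  hom_submodule : forall n, submodule (hom n);
  hom_span : forall S, submodule S -> (forall n, hom n `<=` S) -> S = setT;
  hom_direct : forall m (f : nat -> A), (forall i, hom i (f i)) ->
    \sum_(i < m) f i = 0 -> forall i, (i < m)%N -> f i = 0;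
  hom_star : forall i j x y, hom i x -> hom j y -> hom (i + j)%N (x ⋆ y);
  (* by linearity x need not be homogeneous *)
  hom_pre_Lie : forall i j x y z, hom i y -> hom j z ->
    associator x y z = (-1) ^+ (i * j) *: associator x z y }.

Section Submodule.
Variable (S : set A) (sS : submodule S).
Lemma submodule0 : S 0. Proof. by case: sS. Qed.
Lemma submoduleZ c x : S x -> S (c *: x).
Proof. by case: sS => s0 sl Sx; rewrite -[_ *: _]addr0; apply: sl. Qed.
Lemma submoduleD x y : S x -> S y -> S (x + y).
Proof. by case: sS => s0 sl Sx Sy; rewrite -[x]scale1r; apply: sl. Qed.
Lemma submoduleN x : S x -> S (- x).
Proof. by rewrite -scaleN1r; apply: submoduleZ. Qed.
Lemma submoduleB x y : S x -> S y -> S (x - y).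
Proof. by move=> Sx /submoduleN; apply: submoduleD. Qed.
Lemma submodule_sum m (f : 'I_m -> A) : (forall i, S (f i)) -> S (\sum_i f i).
Proof.
by move=> Sf; elim/big_ind: _ => // [|x y]; [exact: submodule0|exact: submoduleD].
Qed.
End Submodule.

Lemma ideal_generatedP S : two_sided_ideal (ideal_generated S).
Proof.
split; first split.
- by move=> T [[[]]].
- by move=> c x y Sx Sy T TS; case: (TS) => [[[_ l] _] _]; apply: l;
    [exact: Sx|exact: Sy].
- move=> x y Sx; split=> T TS; case: (TS) => [[_ l] _].
    by case: (l x y (Sx T TS)).
  by case: (l x y (Sx T TS)).
Qed.

Lemma associatorZl c x y z : associator (c *: x) y z = c *: associator x y z.
Proof. by rewrite /associator !starZl scalerBr. Qed.
Lemma associatorZm c x y z : associator x (c *: y) z = c *: associator x y z.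
Proof. by rewrite /associator !(starZl, starZr) scalerBr. Qed.
Lemma associatorZr c x y z : associator x y (c *: z) = c *: associator x y z.
Proof. by rewrite /associator !(starZl, starZr) scalerBr. Qed.
(* An ungraded pre-Lie algebra is a graded one concentrated in degree 0. *)
Lemma pre_Lie_graded : pre_Lie ->
  graded_pre_Lie (fun n => if n is 0 then setT else [set 0]).
Proof.
move=> plA; split.
- case=> [|n]; split=> //= c x y -> ->; by rewrite scaler0 addr0.
- by move=> S sS hS; apply/seteqP; split=> // x _; exact: (hS 0).
- move=> [//|m] f hf; rewrite big_ord_recl big1 ?addr0 => [f0 [//|i] _|i _].
    exact: (hf i.+1).
  exact: (hf i.+1).
- move=> [|i] [|j] x y //=.
  + by move=> _ ->; rewrite star0r.
  + by move=> ->; rewrite star0l.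
  + by move=> ->; rewrite star0l.
- move=> [|i] [|j] x y z /=.
  + by move=> _ _; rewrite expr0 scale1r plA.
  + by move=> _ ->; rewrite plA mul0n expr0 scale1r.
  + by move=> -> _; rewrite plA muln0 expr0 scale1r.
  + by move=> -> ->; rewrite /associator !(star0l, star0r) subr0 scaler0.
Qed.

End NonAssoc.

Definition alg_morphism (k : fieldType) (A B : naAlgType k) (f : A -> B) : Prop :=
  linear f /\ {morph f : x y / x ⋆ y}.

Section Free.
Variables (k : fieldType) (V : lmodType k) (D : Type).

(* The free graded pre-Lie algebra on the vector space V in degree 0 and the
   free generators D in degree 1: formal expressions modulo the least congruence
   forced by the axioms of a graded pre-Lie algebra and the linearity of Gen.
   See free_graded and free_universal. *)
Inductive expr : Type :=
| Zero | Add of expr & expr | Scale of k & expr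
| Gen of V | Dum of D | Mul of expr & expr.

Inductive hdeg : nat -> expr -> Prop :=
| hdeg_zero n : hdeg n Zero
| hdeg_add n a b : hdeg n a -> hdeg n b -> hdeg n (Add a b)
| hdeg_scale n c a : hdeg n a -> hdeg n (Scale c a)
| hdeg_gen v : hdeg 0 (Gen v)
| hdeg_dum t : hdeg 1 (Dum t)
| hdeg_mul m n a b : hdeg m a -> hdeg n b -> hdeg (m + n) (Mul a b).

Definition Asso a b c := Add (Mul (Mul a b) c) (Scale (-1) (Mul a (Mul b c))).

Inductive eqv : expr -> expr -> Prop :=
| eqv_refl a : eqv a a
| eqv_sym a b : eqv a b -> eqv b a
| eqv_trans a b c : eqv a b -> eqv b c -> eqv a c
| eqv_add a a' b b' : eqv a a' -> eqv b b' -> eqv (Add a b) (Add a' b')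
| eqv_scale c a a' : eqv a a' -> eqv (Scale c a) (Scale c a')
| eqv_mul a a' b b' : eqv a a' -> eqv b b' -> eqv (Mul a b) (Mul a' b')
| eqv_addA a b c : eqv (Add a (Add b c)) (Add (Add a b) c)
| eqv_addC a b : eqv (Add a b) (Add b a)
| eqv_add0 a : eqv (Add Zero a) a
| eqv_addN a : eqv (Add (Scale (-1) a) a) Zero
| eqv_scaleA c e a : eqv (Scale c (Scale e a)) (Scale (c * e) a)
| eqv_scale1 a : eqv (Scale 1 a) a
| eqv_scaleDr c a b : eqv (Scale c (Add a b)) (Add (Scale c a) (Scale c b))
| eqv_scaleDl c e a : eqv (Scale (c + e) a) (Add (Scale c a) (Scale e a))
| eqv_mulDl a b c : eqv (Mul (Add a b) c) (Add (Mul a c) (Mul b c))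
| eqv_mulDr a b c : eqv (Mul a (Add b c)) (Add (Mul a b) (Mul a c))
| eqv_mulZl c a b : eqv (Mul (Scale c a) b) (Scale c (Mul a b))
| eqv_mulZr c a b : eqv (Mul a (Scale c b)) (Scale c (Mul a b))
| eqv_gen c v w : eqv (Gen (c *: v + w)) (Add (Scale c (Gen v)) (Gen w))
| eqv_pre_Lie i j a b c : hdeg i b -> hdeg j c ->
    eqv (Asso a b c) (Scale ((-1) ^+ (i * j)) (Asso a c b)).

HB.instance Definition _ := gen_eqMixin expr.
HB.instance Definition _ := gen_choiceMixin expr.

Definition eqvb (a b : expr) : bool := `[< eqv a b >].

Lemma eqvb_refl : reflexive eqvb.
Proof. by move=> a; apply/asboolP; exact: eqv_refl. Qed.
Lemma eqvb_sym : symmetric eqvb.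
Proof. by move=> a b; apply/asboolP/asboolP; exact: eqv_sym. Qed.
Lemma eqvb_trans : transitive eqvb.
Proof.
move=> b a c /asboolP ab /asboolP bc.
by apply/asboolP; exact: eqv_trans ab bc.
Qed.
Canonical eqvb_equiv := EquivRel eqvb eqvb_refl eqvb_sym eqvb_trans.

Definition free_pre_Lie : Type := {eq_quot eqvb}.
HB.instance Definition _ := EqQuotient.on free_pre_Lie.
HB.instance Definition _ := Choice.on free_pre_Lie.

Definition cls (e : expr) : free_pre_Lie := \pi_free_pre_Lie e.

Lemma clsP a b : cls a = cls b <-> eqv a b.
Proof.
split=> [ab|ab]; first by apply/asboolP; apply/(@eqmodP _ eqvb_equiv).
by apply/(@eqmodP _ eqvb_equiv)/asboolP.
Qed.

Lemma cls_ind (P : free_pre_Lie -> Prop) : (forall e, P (cls e)) -> forall x, P x.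
Proof. by move=> Pe x; rewrite -[x]reprK; exact: Pe. Qed.

Lemma repr_cls a : eqv (repr (cls a)) a.
Proof. by apply/clsP; rewrite /cls reprK. Qed.

Definition free_add (x y : free_pre_Lie) := cls (Add (repr x) (repr y)).
Definition free_opp (x : free_pre_Lie) := cls (Scale (-1) (repr x)).
Definition free_scale c (x : free_pre_Lie) := cls (Scale c (repr x)).
Definition free_star (x y : free_pre_Lie) := cls (Mul (repr x) (repr y)).

Lemma free_addE a b : free_add (cls a) (cls b) = cls (Add a b).
Proof. by apply/clsP; apply: eqv_add; exact: repr_cls. Qed.
Lemma free_scaleE c a : free_scale c (cls a) = cls (Scale c a).
Proof. by apply/clsP; apply: eqv_scale; exact: repr_cls. Qed.
Lemma free_oppE a : free_opp (cls a) = cls (Scale (-1) a).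
Proof. exact: free_scaleE. Qed.
Lemma free_starE a b : free_star (cls a) (cls b) = cls (Mul a b).
Proof. by apply/clsP; apply: eqv_mul; exact: repr_cls. Qed.

Fact free_addA : associative free_add.
Proof.
by do 3!elim/cls_ind=> ?; rewrite !free_addE; apply/clsP; exact: eqv_addA.
Qed.
Fact free_addC : commutative free_add.
Proof. by do 2!elim/cls_ind=> ?; rewrite !free_addE; apply/clsP; exact: eqv_addC. Qed.
Fact free_add0 : left_id (cls Zero) free_add.
Proof. by elim/cls_ind=> ?; rewrite !free_addE; apply/clsP; exact: eqv_add0. Qed.
Fact free_addN : left_inverse (cls Zero) free_opp free_add.
Proof.
by elim/cls_ind=> ?; rewrite free_oppE !free_addE; apply/clsP; exact: eqv_addN.
Qed.
HB.instance Definition _ := GRing.isZmodule.Build free_pre_Lie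
  free_addA free_addC free_add0 free_addN.

Lemma clsD a b : cls (Add a b) = cls a + cls b.
Proof. by rewrite -free_addE. Qed.

Fact free_scaleA c e x : free_scale c (free_scale e x) = free_scale (c * e) x.
Proof.
by elim/cls_ind: x => a; rewrite !free_scaleE; apply/clsP; exact: eqv_scaleA.
Qed.
Fact free_scale1 : left_id 1 free_scale.
Proof. by elim/cls_ind=> a; rewrite !free_scaleE; apply/clsP; exact: eqv_scale1. Qed.
Fact free_scaleDr : right_distributive free_scale +%R.
Proof.
move=> c; do 2!elim/cls_ind=> ?; rewrite -clsD !free_scaleE -clsD.
by apply/clsP; exact: eqv_scaleDr.
Qed.
Fact free_scaleDl x : {morph free_scale^~ x : c e / c + e}.
Proof.
elim/cls_ind: x => a c e; rewrite !free_scaleE -clsD.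
by apply/clsP; exact: eqv_scaleDl.
Qed.
HB.instance Definition _ := GRing.Zmodule_isLmodule.Build k free_pre_Lie
  free_scaleA free_scale1 free_scaleDr free_scaleDl.

Lemma clsZ c a : cls (Scale c a) = c *: cls a.
Proof. by rewrite -free_scaleE. Qed.

Fact free_starDl : left_distributive free_star +%R.
Proof.
do 3!elim/cls_ind=> ?; rewrite -clsD !free_starE -clsD.
by apply/clsP; exact: eqv_mulDl.
Qed.
Fact free_starDr : right_distributive free_star +%R.
Proof.
do 3!elim/cls_ind=> ?; rewrite -clsD !free_starE -clsD.
by apply/clsP; exact: eqv_mulDr.
Qed.
Fact free_starZl (c : k) x y : free_star (c *: x) y = c *: free_star x y.
Proof.
elim/cls_ind: x => a; elim/cls_ind: y => b; rewrite -clsZ !free_starE -clsZ.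
by apply/clsP; exact: eqv_mulZl.
Qed.
Fact free_starZr (c : k) x y : free_star x (c *: y) = c *: free_star x y.
Proof.
elim/cls_ind: x => a; elim/cls_ind: y => b; rewrite -clsZ !free_starE -clsZ.
by apply/clsP; exact: eqv_mulZr.
Qed.
HB.instance Definition _ := Lmodule_isNonAssocAlgebra.Build k free_pre_Lie
  free_starDl free_starDr free_starZl free_starZr.

Lemma clsM a b : cls (Mul a b) = cls a ⋆ cls b.
Proof. by rewrite -free_starE. Qed.
Lemma cls0 : cls Zero = 0. Proof. by []. Qed.
Lemma clsAsso a b c : cls (Asso a b c) = associator (cls a) (cls b) (cls c).
Proof. by rewrite clsD clsZ !clsM scaleN1r. Qed.

Definition gen (v : V) : free_pre_Lie := cls (Gen v).
Definition dum (t : D) : free_pre_Lie := cls (Dum t).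

Lemma gen_linear : linear gen.
Proof. by move=> c v w; rewrite -clsZ -clsD; apply/clsP; exact: eqv_gen. Qed.
HB.instance Definition _ := GRing.isLinear.Build k V free_pre_Lie _ gen gen_linear.

Definition free_hom (n : nat) : set free_pre_Lie :=
  [set x | exists2 e, hdeg n e & x = cls e].

Lemma free_hom_pre_Lie i j a b c : hdeg i b -> hdeg j c ->
  associator a (cls b) (cls c) = (-1) ^+ (i * j) *: associator a (cls c) (cls b).
Proof.
move=> hb hc; elim/cls_ind: a => a; rewrite -!clsAsso -clsZ.
by apply/clsP; exact: eqv_pre_Lie.
Qed.

Lemma free_hom_submodule n : submodule (free_hom n).
Proof.
split; first by exists Zero => //; constructor.
move=> c _ _ [a ha ->] [b hb ->]; exists (Add (Scale c a) b).
  by apply: hdeg_add => //; exact: hdeg_scale.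
by rewrite clsD clsZ.
Qed.

Lemma free_hom_star i j x y :
  free_hom i x -> free_hom j y -> free_hom (i + j)%N (x ⋆ y).
Proof.
by move=> [a ha ->] [b hb ->]; exists (Mul a b); [constructor|rewrite clsM].
Qed.

Lemma free_hom_span S : submodule S -> (forall n, free_hom n `<=` S) -> S = setT.
Proof.
move=> sS hS; apply/seteqP; split=> // x _; elim/cls_ind: x => e.
elim: e S sS hS => [|a IHa b IHb|c a IHa|v|t|a IHa b IHb] S sS hS.
- exact: (submodule0 sS).
- by rewrite clsD; apply: (submoduleD sS) => //; [exact: IHa|exact: IHb].
- by rewrite clsZ; apply: (submoduleZ sS) => //; exact: IHa.
- by apply: (hS 0); exists (Gen v) => //; constructor.
- by apply: (hS 1); exists (Dum t) => //; constructor.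
rewrite clsM; apply: (IHa [set x | S (x ⋆ cls b)]).
  split=> [|c x y Sx Sy] /=; first by rewrite star0l; exact: (submodule0 sS).
  by rewrite starDl starZl; apply: sS.2.
move=> i x hx /=; apply: (IHb [set y | S (x ⋆ y)]).
  split=> [|c y z Sy Sz] /=; first by rewrite star0r; exact: (submodule0 sS).
  by rewrite starDr starZr; apply: sS.2.
by move=> j y hy; apply: (hS (i + j)%N); exact: free_hom_star.
Qed.

Fixpoint compE (n : nat) (e : expr) : free_pre_Lie :=
  match e with
  | Zero => 0
  | Add a b => compE n a + compE n b
  | Scale c a => c *: compE n a
  | Gen v => if n == 0 then gen v else 0
  | Dum t => if n == 1 then dum t else 0
  | Mul a b => \sum_(i < n.+1) compE i a ⋆ compE (n - i) b
  end.

Lemma compE_hdeg m e n : hdeg m e -> compE n e = if n == m then cls e else 0.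
Proof.
move=> he; elim: he n => {m e}.
- by move=> m n /=; rewrite cls0 if_same.
- by move=> m a b _ IHa _ IHb n /=; rewrite IHa IHb clsD; case: eqP; rewrite ?addr0.
- by move=> m c a _ IHa n /=; rewrite IHa clsZ; case: eqP; rewrite ?scaler0.
- by [].
- by [].
move=> p q a b _ IHa _ IHb n /=; rewrite clsM.
under eq_bigr => i _ do rewrite IHa IHb.
have [->|npq] := eqVneq n (p + q)%N.
  have lt_p : (p < (p + q).+1)%N by rewrite ltnS leq_addr.
  rewrite (bigD1 (Ordinal lt_p)) //= eqxx addKn eqxx big1 ?addr0 // => i.
  by rewrite -val_eqE /= => /negPf->; rewrite star0l.
apply: big1 => i _; case: eqP => [ip|_]; last by rewrite star0l.
case: eqP => [nq|_]; last by rewrite star0r.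
by case/eqP: npq; rewrite -ip -nq subnKC // -ltnS.
Qed.

Lemma compE_Mulr m a b n : hdeg m b ->
  compE n (Mul a b) = if (m <= n)%N then compE (n - m) a ⋆ cls b else 0.
Proof.
move=> hb /=; under eq_bigr => i _ do rewrite (compE_hdeg _ hb).
case: leqP => [mn|nm].
  have lt_p : (n - m < n.+1)%N by rewrite ltnS leq_subr.
  rewrite (bigD1 (Ordinal lt_p)) //= subKn // eqxx big1 ?addr0 // => i.
  rewrite -val_eqE /= => /eqP inm; case: eqP => [nim|_]; last by rewrite star0r.
  by case: inm; rewrite -nim subKn // -ltnS.
apply: big1 => i _; case: eqP => [h|_]; last by rewrite star0r.
by move: nm; rewrite -h ltnNge leq_subr.
Qed.

Lemma compE_Asso i j a b c n : hdeg i b -> hdeg j c ->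
  compE n (Asso a b c) =
    if (i + j <= n)%N then associator (compE (n - (i + j)) a) (cls b) (cls c)
    else 0.
Proof.
move=> hb hc.
have -> : compE n (Asso a b c) =
    compE n (Mul (Mul a b) c) - compE n (Mul a (Mul b c)).
  by rewrite -scaleN1r.
rewrite (compE_Mulr _ _ hc) (compE_Mulr _ _ (hdeg_mul hb hc)).
case: (leqP (i + j) n) => ijn; last first.
  case: leqP => jn; rewrite ?subr0 // (compE_Mulr _ _ hb).
  by rewrite leq_subRL // addnC leqNgt ijn star0l.
have jn : (j <= n)%N by apply: leq_trans ijn; exact: leq_addl.
rewrite jn (compE_Mulr _ _ hb) leq_subRL // addnC ijn -subnDA [(j + i)%N]addnC.
by rewrite clsM.
Qed.

Lemma compE_eqv a b : eqv a b -> forall n, compE n a = compE n b.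
Proof.
elim=> {a b} //.
- by move=> a b c _ IH1 _ IH2 n; rewrite IH1.
- by move=> a a' b b' _ IHa _ IHb n /=; rewrite IHa IHb.
- by move=> c a a' _ IHa n /=; rewrite IHa.
- by move=> a a' b b' _ IHa _ IHb n /=; apply: eq_bigr => i _; rewrite IHa IHb.
- by move=> a b c n /=; rewrite addrA.
- by move=> a b n /=; rewrite addrC.
- by move=> a n /=; rewrite add0r.
- by move=> a n /=; rewrite scaleN1r addNr.
- by move=> c e a n /=; rewrite scalerA.
- by move=> a n /=; rewrite scale1r.
- by move=> c a b n /=; rewrite scalerDr.
- by move=> c e a n /=; rewrite scalerDl.
- by move=> a b c n /=; rewrite -big_split; apply: eq_bigr => i _; rewrite starDl.
- by move=> a b c n /=; rewrite -big_split; apply: eq_bigr => i _; rewrite starDr.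
- by move=> c a b n /=; rewrite scaler_sumr; apply: eq_bigr => i _; rewrite starZl.
- by move=> c a b n /=; rewrite scaler_sumr; apply: eq_bigr => i _; rewrite starZr.
- by move=> c v w n /=; case: eqP; rewrite ?scaler0 ?addr0 // => _; exact: gen_linear.
- move=> i j a b c hb hc n.
  rewrite -[RHS]/(_ *: compE n (Asso a c b)) (compE_Asso _ _ hb hc).
  rewrite (compE_Asso _ _ hc hb) addnC; case: leqP => _; last by rewrite scaler0.
  exact: free_hom_pre_Lie.
Qed.

Definition hcomp n (x : free_pre_Lie) : free_pre_Lie := compE n (repr x).

Lemma hcomp_cls n e : hcomp n (cls e) = compE n e.
Proof. by apply: compE_eqv; exact: repr_cls. Qed.

Lemma hcomp_linear n : linear (hcomp n).
Proof.
move=> c x y; elim/cls_ind: x => a; elim/cls_ind: y => b.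
by rewrite -clsZ -clsD !hcomp_cls.
Qed.
HB.instance Definition _ n :=
  GRing.isLinear.Build k free_pre_Lie free_pre_Lie _ (hcomp n) (hcomp_linear n).

Lemma hcomp_star n x y :
  hcomp n (x ⋆ y) = \sum_(i < n.+1) hcomp i x ⋆ hcomp (n - i) y.
Proof.
elim/cls_ind: x => a; elim/cls_ind: y => b.
by rewrite -clsM hcomp_cls /=; apply: eq_bigr => i _; rewrite !hcomp_cls.
Qed.

Lemma hcomp_hom m n x : free_hom m x -> hcomp n x = if n == m then x else 0.
Proof. by move=> [e he ->]; rewrite hcomp_cls (compE_hdeg _ he). Qed.

Lemma hcomp_sum m (f : nat -> free_pre_Lie) : (forall i, free_hom i (f i)) ->
  forall i, (i < m)%N -> hcomp i (\sum_(j < m) f j) = f i.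
Proof.
move=> hf i im; rewrite linear_sum (bigD1 (Ordinal im)) //= (hcomp_hom _ (hf i)).
rewrite eqxx big1 ?addr0 // => j; rewrite -val_eqE /= (hcomp_hom _ (hf j)).
by rewrite eq_sym => /negPf->.
Qed.

Lemma free_graded : graded_pre_Lie free_hom.
Proof.
split.
- exact: free_hom_submodule.
- exact: free_hom_span.
- by move=> m f hf f0 i im; rewrite -(hcomp_sum hf im) f0 linear0.
- exact: free_hom_star.
- by move=> i j x _ _ [b hb ->] [c hc ->]; exact: free_hom_pre_Lie.
Qed.

Section Universal.
Variables (B : naAlgType k) (homB : nat -> set B) (gB : graded_pre_Lie homB).
Variables (f : V -> B) (g : D -> B).
Hypotheses (f_lin : linear f) (hf : forall v, homB 0 (f v))
  (hg : forall t, homB 1 (g t)).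

Fixpoint evalE (e : expr) : B :=
  match e with
  | Zero => 0
  | Add a b => evalE a + evalE b
  | Scale c a => c *: evalE a
  | Gen v => f v
  | Dum t => g t
  | Mul a b => evalE a ⋆ evalE b
  end.

Definition free_lift (x : free_pre_Lie) : B := evalE (repr x).

Lemma evalE_hom n e : hdeg n e -> homB n (evalE e).
Proof.
elim=> {n e} //=.
- by move=> n; exact: (submodule0 (hom_submodule gB n)).
- by move=> n a b _ ? _ ?; apply: (submoduleD (hom_submodule gB n)).
- by move=> n c a _ ?; apply: (submoduleZ (hom_submodule gB n)).
- by move=> m n a b _ ? _ ?; exact: (hom_star gB).
Qed.

Lemma evalE_eqv a b : eqv a b -> evalE a = evalE b.
Proof.
elim=> {a b} //=.
- by move=> a b c _ -> _ ->.
- by move=> a a' b b' _ -> _ ->.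
- by move=> c a a' _ ->.
- by move=> a a' b b' _ -> _ ->.
- by move=> a b c; rewrite addrA.
- by move=> a b; rewrite addrC.
- by move=> a; rewrite add0r.
- by move=> a; rewrite scaleN1r addNr.
- by move=> c e a; rewrite scalerA.
- by move=> a; rewrite scale1r.
- by move=> c a b; rewrite scalerDr.
- by move=> c e a; rewrite scalerDl.
- by move=> a b c; rewrite starDl.
- by move=> a b c; rewrite starDr.
- by move=> c a b; rewrite starZl.
- by move=> c a b; rewrite starZr.
- move=> i j a b c hb hc; rewrite !scaleN1r.
  exact: (hom_pre_Lie gB _ (evalE_hom hb) (evalE_hom hc)).
Qed.

Lemma free_liftE e : free_lift (cls e) = evalE e.
Proof. by apply: evalE_eqv; exact: repr_cls. Qed.

Lemma free_lift_linear : linear free_lift.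
Proof.
move=> c x y; elim/cls_ind: x => a; elim/cls_ind: y => b.
by rewrite -clsZ -clsD !free_liftE.
Qed.

Lemma free_lift_morphism : alg_morphism free_lift.
Proof.
split; first exact: free_lift_linear.
move=> x y; elim/cls_ind: x => a; elim/cls_ind: y => b.
by rewrite -clsM !free_liftE.
Qed.

Lemma free_lift_hom n x : free_hom n x -> homB n (free_lift x).
Proof. by move=> [e he ->]; rewrite free_liftE; exact: evalE_hom. Qed.

Lemma free_universal : exists! phi : free_pre_Lie -> B,
  [/\ alg_morphism phi, forall n x, free_hom n x -> homB n (phi x),
      forall v, phi (gen v) = f v & forall t, phi (dum t) = g t].
Proof.
exists free_lift; split.
  by split=> [|n x|v|t]; rewrite ?free_liftE //;
    [exact: free_lift_morphism|exact: free_lift_hom].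
move=> psi [[psi_l psi_m] _ psi_g psi_d]; apply/funext => x.
elim/cls_ind: x => e; rewrite free_liftE; elim: e => /=.
- by rewrite cls0 (lin0 psi_l).
- by move=> a -> b ->; rewrite clsD (linD psi_l).
- by move=> c a ->; rewrite clsZ (linZ psi_l).
- by move=> v; rewrite -psi_g.
- by move=> t; rewrite -psi_d.
- by move=> a -> b ->; rewrite clsM psi_m.
Qed.
End Universal.

End Free.

Section IdealQuotient.
Variables (k : fieldType) (A : naAlgType k) (S : set A).

Local Notation I := (ideal_generated S).
Let Isub : submodule I := (ideal_generatedP S).1.

Definition eqi (x y : A) : bool := `[< I (x - y) >].

Lemma eqi_refl : reflexive eqi.
Proof. by move=> x; apply/asboolP; rewrite subrr; exact: (submodule0 Isub). Qed.
Lemma eqi_sym : symmetric eqi.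
Proof.
by move=> x y; apply/asboolP/asboolP => /(submoduleN Isub); rewrite opprB.
Qed.
Lemma eqi_trans : transitive eqi.
Proof.
move=> y x z /asboolP xy /asboolP yz; apply/asboolP.
by have := submoduleD Isub xy yz; rewrite addrA subrK.
Qed.
Canonical eqi_equiv := EquivRel eqi eqi_refl eqi_sym eqi_trans.

Definition ideal_quot : Type := {eq_quot eqi}.
HB.instance Definition _ := EqQuotient.on ideal_quot.
HB.instance Definition _ := Choice.on ideal_quot.

Definition qproj (x : A) : ideal_quot := \pi_ideal_quot x.

Lemma qprojP x y : qproj x = qproj y <-> I (x - y).
Proof.
split=> [xy|xy]; first by apply/asboolP; apply/(@eqmodP _ eqi_equiv).
by apply/(@eqmodP _ eqi_equiv)/asboolP.
Qed.

Lemma qproj_ind (P : ideal_quot -> Prop) : (forall x, P (qproj x)) -> forall x, P x.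
Proof. by move=> Px x; rewrite -[x]reprK; exact: Px. Qed.

Lemma repr_proj x : I (repr (qproj x) - x).
Proof. by apply/qprojP; rewrite /qproj reprK. Qed.

Definition quot_add (x y : ideal_quot) := qproj (repr x + repr y).
Definition quot_opp (x : ideal_quot) := qproj (- repr x).
Definition quot_scale c (x : ideal_quot) := qproj (c *: repr x).
Definition quot_star (x y : ideal_quot) := qproj (repr x ⋆ repr y).

Lemma quot_addE x y : quot_add (qproj x) (qproj y) = qproj (x + y).
Proof.
by apply/qprojP; rewrite opprD addrACA; apply: (submoduleD Isub); exact: repr_proj.
Qed.
Lemma quot_oppE x : quot_opp (qproj x) = qproj (- x).
Proof. by apply/qprojP; rewrite -opprD; apply: (submoduleN Isub); exact: repr_proj. Qed.
Lemma quot_scaleE c x : quot_scale c (qproj x) = qproj (c *: x).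
Proof.
by apply/qprojP; rewrite -scalerBr; apply: (submoduleZ Isub); exact: repr_proj.
Qed.
Lemma quot_starE x y : quot_star (qproj x) (qproj y) = qproj (x ⋆ y).
Proof.
apply/qprojP; set u := repr _; set v := repr _.
have -> : u ⋆ v - x ⋆ y = (u - x) ⋆ v + x ⋆ (v - y).
  by rewrite starBl starBr addrA subrK.
apply: (submoduleD Isub).
  by case: ((ideal_generatedP S).2 (u - x) v (repr_proj x)).
by case: ((ideal_generatedP S).2 (v - y) x (repr_proj y)).
Qed.

Fact quot_addA : associative quot_add.
Proof. by do 3!elim/qproj_ind=> ?; rewrite !quot_addE addrA. Qed.
Fact quot_addC : commutative quot_add.
Proof. by do 2!elim/qproj_ind=> ?; rewrite !quot_addE addrC. Qed.
Fact quot_add0 : left_id (qproj 0) quot_add.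
Proof. by elim/qproj_ind=> ?; rewrite quot_addE add0r. Qed.
Fact quot_addN : left_inverse (qproj 0) quot_opp quot_add.
Proof. by elim/qproj_ind=> ?; rewrite quot_oppE quot_addE addNr. Qed.
HB.instance Definition _ := GRing.isZmodule.Build ideal_quot
  quot_addA quot_addC quot_add0 quot_addN.

Lemma qprojD x y : qproj (x + y) = qproj x + qproj y.
Proof. by rewrite -quot_addE. Qed.

Fact quot_scaleA c e x : quot_scale c (quot_scale e x) = quot_scale (c * e) x.
Proof. by elim/qproj_ind: x => x; rewrite !quot_scaleE scalerA. Qed.
Fact quot_scale1 : left_id 1 quot_scale.
Proof. by elim/qproj_ind=> x; rewrite quot_scaleE scale1r. Qed.
Fact quot_scaleDr : right_distributive quot_scale +%R.
Proof.
move=> c; do 2!elim/qproj_ind=> ?.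
by rewrite -qprojD !quot_scaleE -qprojD scalerDr.
Qed.
Fact quot_scaleDl x : {morph quot_scale^~ x : c e / c + e}.
Proof.
by elim/qproj_ind: x => x c e; rewrite !quot_scaleE -qprojD scalerDl.
Qed.
HB.instance Definition _ := GRing.Zmodule_isLmodule.Build k ideal_quot
  quot_scaleA quot_scale1 quot_scaleDr quot_scaleDl.

Lemma qprojZ c x : qproj (c *: x) = c *: qproj x.
Proof. by rewrite -quot_scaleE. Qed.

Fact quot_starDl : left_distributive quot_star +%R.
Proof.
by do 3!elim/qproj_ind=> ?; rewrite -qprojD !quot_starE -qprojD starDl.
Qed.
Fact quot_starDr : right_distributive quot_star +%R.
Proof.
by do 3!elim/qproj_ind=> ?; rewrite -qprojD !quot_starE -qprojD starDr.
Qed.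
Fact quot_starZl (c : k) x y : quot_star (c *: x) y = c *: quot_star x y.
Proof.
elim/qproj_ind: x => x; elim/qproj_ind: y => y.
by rewrite -qprojZ !quot_starE -qprojZ starZl.
Qed.
Fact quot_starZr (c : k) x y : quot_star x (c *: y) = c *: quot_star x y.
Proof.
elim/qproj_ind: x => x; elim/qproj_ind: y => y.
by rewrite -qprojZ !quot_starE -qprojZ starZr.
Qed.
HB.instance Definition _ := Lmodule_isNonAssocAlgebra.Build k ideal_quot
  quot_starDl quot_starDr quot_starZl quot_starZr.

Lemma qprojM x y : qproj (x ⋆ y) = qproj x ⋆ qproj y.
Proof. by rewrite -quot_starE. Qed.

Lemma qproj_linear : linear qproj.
Proof. by move=> c x y; rewrite qprojD qprojZ. Qed.
HB.instance Definition _ := GRing.isLinear.Build k A ideal_quot _ qproj qproj_linear.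

Lemma qproj_morphism : alg_morphism qproj.
Proof. by split; [exact: qproj_linear|exact: qprojM]. Qed.

Lemma qproj0P x : qproj x = 0 <-> I x.
Proof. by rewrite -(linear0 qproj) qprojP subr0. Qed.

Lemma qproj_associator x y z :
  qproj (associator x y z) = associator (qproj x) (qproj y) (qproj z).
Proof. by rewrite linearB /= !qprojM. Qed.

Definition quot_hom (hom : nat -> set A) (n : nat) : set ideal_quot :=
  qproj @` hom n.

End IdealQuotient.

Section Differential.
Variables (k : fieldType) (V : lmodType k).

(* With no generator of degree 1 the grading and its signs are trivial, and this
   is the free (ungraded) pre-Lie algebra: pL_pre_Lie and pL_universal. *)
Definition pL : Type := free_pre_Lie V void.
HB.instance Definition _ := NonAssocAlgebra.on pL.

Definition pLs : Type := free_pre_Lie V unit.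
HB.instance Definition _ := NonAssocAlgebra.on pLs.

Definition pL_gen : V -> pL := @gen k V void.

Definition pLs_gen : V -> pLs := @gen k V unit.
Definition pLs_dummy : pLs := dum V tt.

Definition pLs_hom (n : nat) : set pLs := @free_hom k V unit n.

Definition rpL : Type := ideal_quot [set pLs_dummy ⋆ pLs_dummy].
HB.instance Definition _ := NonAssocAlgebra.on rpL.

Definition rpL_hom (n : nat) : set rpL := quot_hom pLs_hom n.
Definition rpL_gen (v : V) : rpL := qproj _ (pLs_gen v).
Definition rpL_dummy : rpL := qproj _ pLs_dummy.


Lemma pL_hom0 (x : pL) : free_hom 0 x.
Proof.
elim/cls_ind: x => e; exists e => //.
elim: e => [|a IHa b IHb|c a IHa|v|[]|a IHa b IHb]; try by constructor.
by rewrite -[0%N]/(0 + 0)%N; constructor.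
Qed.

Lemma pL_pre_Lie : pre_Lie pL.
Proof.
move=> x y z.
rewrite (hom_pre_Lie (free_graded V void) x (pL_hom0 y) (pL_hom0 z)).
by rewrite expr0 scale1r.
Qed.

Lemma pL_universal (B : naAlgType k) (f : V -> B) : pre_Lie B -> linear f ->
  exists! phi : pL -> B, alg_morphism phi /\ forall v, phi (pL_gen v) = f v.
Proof.
move=> plB f_lin.
have [//|//|phi [[pm _ pg _] pu]] :=
  free_universal (pre_Lie_graded plB) (g := of_void B) f_lin.
exists phi; split=> // psi [sm sg]; apply: pu; split=> //.
case=> // n x hx /=.
have := hcomp_hom n.+1 (pL_hom0 x); rewrite (hcomp_hom _ hx) eqxx => ->.
exact: (lin0 sm.1).
Qed.

Lemma pLs_universal (B : naAlgType k) (hom : nat -> set B) (f : V -> B) (b : B) :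
  graded_pre_Lie hom -> linear f -> (forall v, hom 0 (f v)) -> hom 1 b ->
  exists! phi : pLs -> B,
    [/\ alg_morphism phi, forall n x, pLs_hom n x -> hom n (phi x),
        forall v, phi (pLs_gen v) = f v & phi pLs_dummy = b].
Proof.
move=> gB f_lin hf hb.
have [phi [[pm ph pg pd] pu]] :=
  free_universal gB (g := fun _ : unit => b) f_lin hf (fun=> hb).
exists phi; split=> [|psi [sm sh sg sd]]; first by split=> //; exact: pd.
by apply: pu; split=> // -[].
Qed.

(* The ideal generated by the homogeneous element ∘ ⋆ ∘ is homogeneous. *)
Lemma pLs_comp_ideal n (x : pLs) :
  ideal_generated [set pLs_dummy ⋆ pLs_dummy] x ->
  ideal_generated [set pLs_dummy ⋆ pLs_dummy] (hcomp n x).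
Proof.
set I := ideal_generated _; have [sI iI] : two_sided_ideal I.
  exact: ideal_generatedP.
have mI : I (pLs_dummy ⋆ pLs_dummy) by apply: sub_gen_smallest.
pose T := [set y : pLs | I y /\ forall m, I (hcomp m y)].
suff IT : I `<=` T by move=> /IT [].
apply: smallest_sub; last first.
  move=> _ ->; split=> // m.
  have h2 : free_hom (1 + 1) (pLs_dummy ⋆ pLs_dummy).
    by apply: free_hom_star; exists (Dum V tt) => //; constructor.
  by rewrite (hcomp_hom m h2); case: eqP => // _; exact: (submodule0 sI).
split.
  split; first by split=> [|m]; rewrite ?linear0; exact: (submodule0 sI).
  move=> c y z [Iy cy] [Iz cz]; split=> [|m]; first exact: (sI.2).
  by rewrite linearP; exact: (sI.2 _ _ _ (cy m) (cz m)).
move=> y z [Iy cy]; split; split=> [|m].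
- exact: (iI y z Iy).1.
- by rewrite hcomp_star; apply: (submodule_sum sI) => // i; exact: (iI _ _ (cy i)).1.
- exact: (iI y z Iy).2.
- by rewrite hcomp_star; apply: (submodule_sum sI) => // i; exact: (iI _ _ (cy _)).2.
Qed.

Lemma rpL_graded : graded_pre_Lie rpL_hom.
Proof.
have gA := free_graded V unit; split.
- move=> n; have sn := hom_submodule gA n; split.
    by exists 0; [exact: (submodule0 sn)|rewrite linear0].
  move=> c _ _ [x hx <-] [y hy <-]; exists (c *: x + y); first exact: sn.2.
  by rewrite linearP.
- move=> S sS hS; apply/seteqP; split=> // x _; elim/qproj_ind: x => x.
  suff ST : [set x : pLs | S (qproj _ x)] = setT.
    by have : [set x : pLs | S (qproj _ x)] x by rewrite ST.
  apply: (hom_span gA).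
    split=> [|c y z Sy Sz] /=; first by rewrite linear0; exact: (submodule0 sS).
    by rewrite linearP; exact: sS.2.
  by move=> n y hy; apply: (hS n); exists y.
- move=> m f hf f0 i im.
  have [j|g hg] := @boolp.choice nat pLs (fun i y => pLs_hom i y /\ qproj _ y = f i).
    by case: (hf j) => y hy <-; exists y.
  have : qproj [set pLs_dummy ⋆ pLs_dummy] (\sum_(i < m) g i) = 0.
    rewrite linear_sum -[RHS]f0; apply: eq_bigr => j _; exact: (hg j).2.
  move=> /qproj0P /(pLs_comp_ideal i); rewrite hcomp_sum // => [/qproj0P <-|j].
    by rewrite (hg i).2.
  exact: (hg j).1.
- move=> i j _ _ [x hx <-] [y hy <-]; exists (x ⋆ y); last exact: qprojM.
  exact: (hom_star gA).
- move=> i j x _ _ [y hy <-] [z hz <-]; elim/qproj_ind: x => x.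
  by rewrite -!qproj_associator (hom_pre_Lie gA x hy hz) linearZ.
Qed.

(* The identification of pL(V) with the degree 0 part of rpL(V):
   embed_morphism, embed_gen, embed_inj, embed_range. *)
Definition embed : pL -> rpL := free_lift rpL_gen (of_void rpL).

Lemma rpL_gen_linear : linear rpL_gen.
Proof. by move=> c v w; rewrite /rpL_gen /pLs_gen linearP linearP. Qed.

Lemma rpL_gen_hom v : rpL_hom 0 (rpL_gen v).
Proof. by exists (pLs_gen v) => //; exists (Gen _ v) => //; constructor. Qed.

Lemma rpL_dummy_hom : rpL_hom 1 rpL_dummy.
Proof. by exists pLs_dummy => //; exists (Dum V tt) => //; constructor. Qed.

Lemma embedE e : embed (cls e) = evalE rpL_gen (of_void rpL) e.
Proof.
by apply: (free_liftE rpL_graded rpL_gen_linear) => // v; exact: rpL_gen_hom.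
Qed.

Lemma embed_morphism : alg_morphism embed.
Proof.
by apply: (free_lift_morphism rpL_graded rpL_gen_linear) => // v; exact: rpL_gen_hom.
Qed.

Lemma embed_gen v : embed (pL_gen v) = rpL_gen v.
Proof. exact: embedE. Qed.

Lemma embed_inj : injective embed.
Proof.
have gpL := pre_Lie_graded pL_pre_Lie.
have pgl : linear pL_gen by exact: gen_linear.
have [|//|r [[[rl rm] _ rg rd] _]] := pLs_universal (b := 0) gpL pgl; first by [].
have lift (x : pL) : exists2 y : pLs, embed x = qproj _ y & r y = x.
  elim/cls_ind: x => e; rewrite embedE; elim: e => /=.
  - by exists 0; rewrite ?linear0 // (lin0 rl).
  - move=> a [y -> ry] b [z -> rz]; exists (y + z); first by rewrite linearD.
    by rewrite (linD rl) ry rz clsD.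
  - move=> c a [y -> ry]; exists (c *: y); first by rewrite linearZ.
    by rewrite (linZ rl) ry clsZ.
  - by move=> v; exists (pLs_gen v).
  - by case.
  - move=> a [y -> ry] b [z -> rz]; exists (y ⋆ z); first by rewrite qprojM.
    by rewrite rm ry rz clsM.
have el := embed_morphism.1.
suff ker0 (x : pL) : embed x = 0 -> x = 0.
  move=> x y exy; apply/eqP; rewrite -subr_eq0; apply/eqP/ker0.
  by rewrite -scaleN1r (linD el) (linZ el) exy scaleN1r subrr.
have [y -> ry] := lift x; move=> /qproj0P Iy; rewrite -ry.
suff: ideal_generated [set pLs_dummy ⋆ pLs_dummy] `<=` [set y | r y = 0] by apply.
apply: smallest_sub; last by move=> _ ->; rewrite /= rm rd star0l.
split; first split.
- exact: (lin0 rl).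
- by move=> c u v /= ru rv; rewrite rl ru rv scaler0 addr0.
- by move=> u v /= ru; rewrite !rm ru star0l star0r.
Qed.

Lemma embed_range : range embed = rpL_hom 0.
Proof.
apply/seteqP; split=> [_ [x _ <-]|_ [_ [e he ->] <-]].
  apply: (free_lift_hom rpL_graded rpL_gen_linear) => //; first exact: rpL_gen_hom.
  exact: pL_hom0.
have el := embed_morphism.1.
suff gen0 n f : hdeg n f -> n = 0%N -> range embed (qproj _ (cls f)).
  exact: gen0 he (erefl _).
elim=> {n f e he} //.
- by move=> n _; exists 0; rewrite // (lin0 el) linear0.
- move=> n a b _ IHa _ IHb n0; have [x _ xa] := IHa n0; have [y _ yb] := IHb n0.
  by exists (x + y); rewrite // (linD el) xa yb clsD linearD.
- move=> n c a _ IHa n0; have [x _ xa] := IHa n0.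
  by exists (c *: x); rewrite // (linZ el) xa clsZ linearZ.
- by move=> v _; exists (pL_gen v); rewrite // embed_gen.
- move=> m n a b _ IHa _ IHb mn0.
  have /eqP := mn0; rewrite addn_eq0 => /andP[/eqP m0 /eqP n0].
  have [x _ xa] := IHa m0; have [y _ yb] := IHb n0.
  by exists (x ⋆ y); rewrite // embed_morphism.2 xa yb clsM qprojM.
Qed.

(* rpL and pL* coincide in degree 1. *)
Lemma qproj_inj1 (x : pLs) :
  pLs_hom 1 x -> qproj [set pLs_dummy ⋆ pLs_dummy] x = 0 -> x = 0.
Proof.
move=> hx /qproj0P Ix.
suff : ideal_generated [set pLs_dummy ⋆ pLs_dummy] `<=`
    [set y : pLs | hcomp 0 y = 0 /\ hcomp 1 y = 0].
  by move=> /(_ _ Ix) [_]; rewrite (hcomp_hom _ hx).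
apply: smallest_sub; last first.
  move=> _ ->; have h2 : free_hom (1 + 1) (pLs_dummy ⋆ pLs_dummy).
    by apply: free_hom_star; exists (Dum V tt) => //; constructor.
  by split; rewrite (hcomp_hom _ h2).
split; first split.
- by split; rewrite linear0.
- move=> c y z /= [y0 y1] [z0 z1].
  by split; rewrite linearP /= ?y0 ?y1 ?z0 ?z1 scaler0 addr0.
move=> y z /= [y0 y1]; split; split; rewrite hcomp_star !big_ord_recl big_ord0 /=.
- by rewrite y0 star0l addr0.
- by rewrite y0 y1 !star0l !addr0.
- by rewrite y0 star0r addr0.
- by rewrite y0 y1 !star0r !addr0.
Qed.

Definition rpL_Q (a b : rpL) : rpL :=
  (rpL_dummy ⋆ a) ⋆ b - rpL_dummy ⋆ (a ⋆ b).

Definition is_rpL_d (d : rpL -> rpL) : Prop :=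
  [/\ linear d,
      forall n a, rpL_hom n a -> rpL_hom n.+1 (d a),
      forall v, d (rpL_gen v) = 0,
      d rpL_dummy = 0 &
      forall n a b, rpL_hom n a ->
        d (a ⋆ b) = d a ⋆ b + (-1) ^+ n *: (a ⋆ d b) + rpL_Q a b].

Definition parity : pLs -> pLs := free_lift pLs_gen (fun=> - pLs_dummy).

Lemma pLs_gen_hom v : pLs_hom 0 (pLs_gen v).
Proof. by exists (Gen _ v) => //; constructor. Qed.
Lemma pLs_dummy_hom : pLs_hom 1 pLs_dummy.
Proof. by exists (Dum V tt) => //; constructor. Qed.
Lemma pLs_dummyN_hom (t : unit) : pLs_hom 1 (- pLs_dummy).
Proof. exact (@submoduleN k pLs _ (@free_hom_submodule k V unit 1) _ pLs_dummy_hom). Qed.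

Lemma parityE e : parity (cls e) = evalE pLs_gen (fun=> - pLs_dummy) e.
Proof.
exact: (free_liftE (free_graded V unit) (@gen_linear _ _ _) pLs_gen_hom
  pLs_dummyN_hom).
Qed.

Lemma parity_morphism : alg_morphism parity.
Proof.
exact: (free_lift_morphism (free_graded V unit) (@gen_linear _ _ _) pLs_gen_hom
  pLs_dummyN_hom).
Qed.

Lemma parity_hom n x : pLs_hom n x -> parity x = (-1) ^+ n *: x.
Proof.
move=> [e he ->]; rewrite parityE; elim: he => {n x e} /=.
- by move=> n; rewrite cls0 scaler0.
- by move=> n a b _ -> _ ->; rewrite clsD scalerDr.
- by move=> n c a _ ->; rewrite clsZ !scalerA mulrC.
- by move=> v; rewrite scale1r.
- by move=> [] /=; rewrite expr1 scaleN1r.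
- by move=> m n a b _ -> _ ->; rewrite clsM starZl starZr scalerA exprD.
Qed.

Let p (x : pLs) : rpL := qproj _ x.
Let o := rpL_dummy.
Let pM x y : p (x ⋆ y) = p x ⋆ p y. Proof. exact: qprojM. Qed.

Fixpoint diffE (e : expr V unit) : rpL :=
  match e with
  | Zero => 0
  | Add a b => diffE a + diffE b
  | Scale c a => c *: diffE a
  | Gen v => 0
  | Dum t => 0
  | Mul a b => diffE a ⋆ p (cls b) + p (parity (cls a)) ⋆ diffE b
               + rpL_Q (p (cls a)) (p (cls b))
  end.

Lemma diffE_Asso a b c :
  diffE (Asso a b c) =
    associator (diffE a) (p (cls b)) (p (cls c))
    + associator (p (parity (cls a))) (diffE b) (p (cls c))
    + associator (p (parity (cls a))) (p (parity (cls b))) (diffE c)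
    + (associator (o ⋆ p (cls a)) (p (cls b)) (p (cls c))
       - o ⋆ associator (p (cls a)) (p (cls b)) (p (cls c))
       - p (parity (cls a)) ⋆ associator o (p (cls b)) (p (cls c))).
Proof.
rewrite /= scaleN1r !clsM parity_morphism.2 !pM /rpL_Q -/o.
set X := p (cls a); set Y := p (cls b); set Z := p (cls c).
set X' := p (parity _); set Y' := p (parity _).
move: (diffE a) (diffE b) (diffE c) => dx dy dz.
rewrite /associator !(starDl, starDr, starNl, starNr) !opprD !opprK.
rewrite !addrA [LHS](ACl (1*8*2*9*5*10*3*13*7*14*11*12*4*6)).
exact: subrK.
Qed.

Lemma diffE_hom n e : hdeg n e -> rpL_hom n.+1 (diffE e).
Proof.
have gR := rpL_graded; have sR n := hom_submodule gR n.
have ph m f : hdeg m f -> rpL_hom m (p (cls f)) by move=> hf; exists (cls f); [exists f|].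
elim=> {n e} /=.
- by move=> n; exact: (submodule0 (sR _)).
- by move=> n a b _ ha _ hb; exact: (submoduleD (sR _)).
- by move=> n c a _ ha; exact: (submoduleZ (sR _)).
- by move=> v; exact: (submodule0 (sR _)).
- by move=> t; exact: (submodule0 (sR _)).
move=> m n a b ha da hb db.
have pa := ph _ _ ha; have pb := ph _ _ hb.
apply: (submoduleD (sR _)); first apply: (submoduleD (sR _)).
- exact: (hom_star gR da pb).
- rewrite (@parity_hom m); last by exists a.
  rewrite /p linearZ /= starZl; apply: (submoduleZ (sR _)).
  by rewrite -addnS; exact: (hom_star gR pa db).
- have ho := rpL_dummy_hom; apply: (submoduleB (sR _)); rewrite -add1n.
    by rewrite addnA; exact: (hom_star gR (hom_star gR ho pa) pb).
  exact: (hom_star gR ho (hom_star gR pa pb)).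
Qed.

Lemma diffE_eqv a b : eqv a b -> diffE a = diffE b.
Proof.
have [pyl pym] := parity_morphism.
have pl : linear p by exact: qproj_linear.
have QDl x y z : rpL_Q (x + y) z = rpL_Q x z + rpL_Q y z.
  by rewrite /rpL_Q !(starDl, starDr) opprD addrACA.
have QDr x y z : rpL_Q x (y + z) = rpL_Q x y + rpL_Q x z.
  by rewrite /rpL_Q !(starDl, starDr) opprD addrACA.
have QZl c x y : rpL_Q (c *: x) y = c *: rpL_Q x y.
  by rewrite /rpL_Q !(starZl, starZr) scalerBr.
have QZr c x y : rpL_Q x (c *: y) = c *: rpL_Q x y.
  by rewrite /rpL_Q !(starZl, starZr) scalerBr.
elim=> {a b}.
- by [].
- by [].
- by move=> a b c _ -> _ ->.
- by move=> a a' b b' _ /= -> _ ->.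
- by move=> c a a' _ /= ->.
- by move=> a a' b b' /clsP ca /= -> /clsP cb ->; rewrite ca cb.
- by move=> a b c /=; rewrite addrA.
- by move=> a b /=; rewrite addrC.
- by move=> a /=; rewrite add0r.
- by move=> a /=; rewrite scaleN1r addNr.
- by move=> c e a /=; rewrite scalerA.
- by move=> a /=; rewrite scale1r.
- by move=> c a b /=; rewrite scalerDr.
- by move=> c e a /=; rewrite scalerDl.
- move=> a b c /=.
  by rewrite !clsD !(linD pyl, linD pl) !(QDl, starDl) [LHS](AC (2*2*2) ((1*3*5)*(2*4*6))).
- move=> a b c /=.
  by rewrite !clsD !(linD pl) !(QDr, starDr) [LHS](AC (2*2*2) ((1*3*5)*(2*4*6))).
- move=> c a b /=.
  by rewrite !clsZ !(linZ pyl, linZ pl) !(QZl, starZl) -!scalerDr.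
- move=> c a b /=.
  by rewrite !clsZ !(linZ pl) !(QZr, starZr) -!scalerDr.
- by move=> c v w /=; rewrite scaler0 addr0.
move=> i j a b c hb hc.
rewrite -[RHS]/(_ *: diffE (Asso a c b)) !diffE_Asso.
have plR := hom_pre_Lie rpL_graded.
have ph m f : hdeg m f -> rpL_hom m (p (cls f)) by move=> hf; exists (cls f); [exists f|].
have pyE m f : hdeg m f -> p (parity (cls f)) = (-1) ^+ m *: p (cls f).
  by move=> hf; rewrite (@parity_hom m) ?(linZ pl) //; exists f.
have pb := ph _ _ hb; have pc := ph _ _ hc.
have db := diffE_hom hb; have dc := diffE_hom hc.
rewrite (pyE _ _ hb) (pyE _ _ hc) !associatorZm.
rewrite !(plR _ _ _ _ _ pb pc) (plR _ _ _ _ _ db pc) (plR _ _ _ _ _ pb dc).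
rewrite !starZr !scalerDr !scalerN !scalerA mulSn mulnS !exprD.
by rewrite signrMK (mulrC ((-1) ^+ j)); congr (_ + _); rewrite addrAC.
Qed.

Lemma rpL_d_exists_unique : exists! d, is_rpL_d d.
Proof.
have [pyl pym] := parity_morphism.
have pl : linear p by exact: qproj_linear.
have el x : exists e, x = cls e :> pLs by elim/cls_ind: x => e; exists e.
pose D (x : pLs) : rpL := diffE (repr x).
have DE e : D (cls e) = diffE e by apply: diffE_eqv; exact: repr_cls.
have Dl : linear D.
  move=> c x y; have [a ->] := el x; have [b ->] := el y.
  by rewrite -clsZ -clsD !DE.
have Dm x y : D (x ⋆ y) = D x ⋆ p y + p (parity x) ⋆ D y + rpL_Q (p x) (p y).
  by have [a ->] := el x; have [b ->] := el y; rewrite -clsM !DE.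
have DI x : p x = 0 -> D x = 0.
  move=> /qproj0P Ix.
  suff : ideal_generated [set pLs_dummy ⋆ pLs_dummy] `<=`
      [set x | [/\ p x = 0, p (parity x) = 0 & D x = 0]] by move=> /(_ x Ix) [].
  have poo : p (pLs_dummy ⋆ pLs_dummy) = 0.
    by apply/qproj0P; exact: sub_gen_smallest.
  have pdum : parity pLs_dummy = - pLs_dummy by rewrite parityE.
  apply: smallest_sub; last first.
    move=> _ ->; split; rewrite ?pym ?pdum ?starNl ?starNr ?opprK //.
    rewrite Dm !DE /= star0l star0r !add0r /rpL_Q -/o.
    by move: poo; rewrite pM => ->; rewrite star0l star0r subr0.
  split; first split.
  - by rewrite /= (lin0 pyl) (lin0 pl) (lin0 Dl).
  - move=> c y z /= [y1 y2 y3] [z1 z2 z3].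
    by rewrite pyl !pl Dl y1 y2 y3 z1 z2 z3 scaler0 addr0.
  - move=> y z /= [y1 y2 y3]; rewrite !pym !pM !Dm y1 y2 y3 /rpL_Q.
    by rewrite !(star0l, star0r) !subr0 !addr0.
pose d (x : rpL) : rpL := D (repr x).
have dE x : d (p x) = D x.
  apply/eqP; rewrite -subr_eq0 -scaleN1r -(linZ Dl) -(linD Dl); apply/eqP/DI.
  by rewrite scaleN1r; apply/qproj0P; exact: repr_proj.
have pi x : exists y, x = p y by elim/qproj_ind: x => y; exists y.
have dl : linear d.
  move=> c x y; have [x' ->] := pi x; have [y' ->] := pi y.
  by rewrite -pl !dE Dl.
exists d; split.
  split.
  - exact: dl.
  - by move=> n _ [_ [e he ->] <-]; rewrite dE DE; exact: diffE_hom.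
  - by move=> v; rewrite dE DE.
  - by rewrite dE DE.
  - move=> n _ b [x hx <-]; have [y ->] := pi b.
    rewrite -/(p x) -pM !dE Dm; congr (_ + _ + _).
    by rewrite (parity_hom hx) (linZ pl) starZl.
move=> d' [d'l d'h d'g d'o d'm]; apply/funext.
have dd n e : hdeg n e -> d (p (cls e)) = d' (p (cls e)).
  elim=> {n e}.
  - by move=> n; rewrite dE DE /= cls0 (lin0 pl) (lin0 d'l).
  - move=> n a b _ IHa _ IHb.
    by rewrite clsD (linD pl) (linD d'l) (linD dl) IHa IHb.
  - by move=> n c a _ IHa; rewrite clsZ (linZ pl) (linZ d'l) (linZ dl) IHa.
  - by move=> v; rewrite dE DE; rewrite [RHS]d'g.
  - by move=> [] ; rewrite dE DE; rewrite [RHS]d'o.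
  - move=> m n a b ha IHa hb IHb.
    have hpa : rpL_hom m (p (cls a)) by exists (cls a) => //; exists a.
    rewrite clsM pM (d'm _ _ _ hpa) -IHa -IHb -pM !dE Dm; congr (_ + _ + _).
    by rewrite (@parity_hom m) ?(linZ pl) ?starZl //; exists a.
suff eqT : [set x | d x = d' x] = setT.
  by move=> x; have : [set x | d x = d' x] x by rewrite eqT.
apply: (hom_span rpL_graded).
  split=> [|c x y /= dx dy]; first by rewrite /= (lin0 dl) (lin0 d'l).
  by rewrite dl d'l dx dy.
by move=> n _ [_ [e he ->] <-]; exact: dd he.
Qed.

Definition rpL_d : rpL -> rpL := sval (cid rpL_d_exists_unique).

Lemma rpL_dP : is_rpL_d rpL_d.
Proof. by rewrite /rpL_d; case: cid => d []. Qed.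

Definition Lie_elements : set pL := Lie_generated (range pL_gen).

End Differential.

Arguments Lie_elements {k} V _.

(* Main.v *)
Require Import Defs.
From HB Require Import structures.
From mathcomp Require Import all_boot all_order all_algebra.
From mathcomp Require Import boolp classical_sets functions.

(**
Write A for pL(V) and A_L for its commutator Lie algebra.  The kernel of d
contains V, and it is closed under brackets because Q is symmetric in degree 0;
this gives one inclusion.

For the other one, the pre-Lie identity says that x, a |-> x ⋆ a makes A a right
module over A_L, and A is the free such module on V.  So for a right A_L-module
M and m in M there is a unique module map f_m : A -> M with f_m(v) = m·v on V.
The space A ⊕ M, with M in degree 1 and (a,m) ⋆ (b,n) = (a ⋆ b, m·b), is a graded
pre-Lie algebra with square-zero part M, so ∘ |-> m extends to a morphism from
rpL(V) to it; this morphism sends d(x) to f_m(x) - m·x.  Therefore a kernel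
element x satisfies f_m(x) = m·x for all M and m ([kernel_action_determined]).
Two choices of M then suffice.

Below v{X} stands for the rooted tree with root v and branches the forest X, or
for a sum of such trees: v{X} is the value at X, in the enveloping algebra of A_L,
of the module map sending 1 to v.

First, let M consist of the A-valued functions on words in a basis of V, a
completed tensor product of the tensor algebra T(V) with A.  It shows that x is a
combination of left-normed products (..(v_1 ⋆ v_2) ⋆ ..) ⋆ v_n
([expansion_left_normed]).  The mechanism is a coinvariance argument.  The
equation forces x to be a generator plus a sum of elements graft e_i y_i, where
graft u y = u{v_1 X_1 + ...} for y = v_1{X_1} + ..., with products taken in the
enveloping algebra; it also forces on each y_i, which has smaller weight than x,
the condition on x used for this.  As graft u turns the left-normed product of
v_1, ..., v_n into that of u, v_1, ..., v_n, induction on the weight applies.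

Second, let E be the Euler derivation, equal to n on products of n generators,
and let M = k ⊕ A with 1·a = E(a) and a·b = [a,b].  Then m = 1 gives
E(x) = f_1(x), and f_1 turns left-normed products into left-normed brackets, so
E(x) is a Lie element ([left_normed_Lie_euler]).  This is the argument of the
Dynkin-Specht-Wever theorem.  In characteristic zero E can be inverted on the
components of x, and Lie elements are stable under E, so x itself is a Lie
element ([euler_descent]).

The first step uses coordinates on V; an element of A involves finitely many
vectors, on which some linear retraction of V to a coordinate space is the
identity ([finite_rank_retract]).
*)

Import GRing.Theory.
Local Open Scope classical_set_scope.
Local Open Scope ring_scope.

Set Implicit Arguments.
Unset Strict Implicit.
Unset Printing Implicit Defensive.

(** * Modules over a pre-Lie algebra *)

Section LinearMaps.
Variables (k : fieldType) (A C : lmodType k).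

Lemma linB (f : A -> C) : linear f -> {morph f : x y / x - y}.
Proof. by move=> fl x y; rewrite (linD fl) -[in LHS]scaleN1r (linZ fl) scaleN1r. Qed.

Lemma lin_sum (f : A -> C) (I : finType) (g : I -> A) :
  linear f -> f (\sum_i g i) = \sum_i f (g i).
Proof. by move=> fl; apply: (big_morph f (linD fl) (lin0 fl)). Qed.
End LinearMaps.

Section Subspaces.
Variables (k : fieldType) (U : lmodType k).

Definition subspace (T : set U) : Prop :=
  T 0 /\ forall (c : k) x y, T x -> T y -> T (c *: x + y).

Variables (T : set U) (sT : subspace T).

Lemma subspaceD x y : T x -> T y -> T (x + y).
Proof. by move=> Tx Ty; rewrite -[x]scale1r; apply: sT.2. Qed.

Lemma subspaceZ c x : T x -> T (c *: x).
Proof. by move=> Tx; rewrite -[_ *: _]addr0; apply: sT.2 => //; exact: sT.1. Qed.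

Lemma subspaceB x y : T x -> T y -> T (x - y).
Proof. by move=> Tx /(subspaceZ (-1)); rewrite scaleN1r; exact: subspaceD. Qed.

Lemma subspace_sum (I : finType) (f : I -> U) : (forall i, T (f i)) -> T (\sum_i f i).
Proof. by move=> Tf; elim/big_ind: _ => //; [exact: sT.1|exact: subspaceD]. Qed.

End Subspaces.

Section Smallest.
Variables (k : fieldType) (U : lmodType k).

Lemma smallest_subspace (H : set U -> Prop) (S : set U) :
  (forall T, H T -> subspace T) -> subspace (smallest H S).
Proof.
move=> Hs; split=> [T [HT _]|c x y Sx Sy T ST]; first exact: (Hs T HT).1.
by apply: (Hs T ST.1).2; [exact: Sx|exact: Sy].
Qed.

End Smallest.

Section Jacobi.
Variables (k : fieldType) (A : naAlgType k).

Implicit Types x y z : A.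

Lemma pre_Lie_swap : pre_Lie A -> forall x y z,
  x ⋆ y ⋆ z = x ⋆ z ⋆ y + (x ⋆ (y ⋆ z) - x ⋆ (z ⋆ y)).
Proof.
move=> pl x y z; have /eqP := pl x y z; rewrite /associator subr_eq => /eqP ->.
by rewrite addrAC -addrA addrA addrAC -addrA addrCA addrA.
Qed.

(** Only three instances of the pre-Lie identity enter: they exchange the last
two factors of (x ⋆ y) ⋆ z, (y ⋆ x) ⋆ z and (z ⋆ x) ⋆ y, and all other terms cancel. *)
Lemma commutator_Jacobi : pre_Lie A -> forall x y z,
  commutator (commutator x y) z - commutator (commutator x z) y =
  commutator x (commutator y z).
Proof.
move=> pl x y z; rewrite /commutator !(starBl, starBr).
rewrite (pre_Lie_swap pl x y z) (pre_Lie_swap pl y x z) (pre_Lie_swap pl z x y).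
rewrite !opprD !opprK !addrA.
rewrite [LHS](ACl (2*3*4*10*1*9*6*14*8*12*7*11*5*13)).
by rewrite /= !(subrK, addrK).
Qed.

End Jacobi.

(** Right modules over the commutator Lie algebra of A. *)
Record rmodule (k : fieldType) (A : naAlgType k) := RModule {
  rmod_sort :> lmodType k;
  ract : rmod_sort -> A -> rmod_sort;
  ract_linl : forall a, linear (ract^~ a);
  ract_linr : forall m, linear (ract m);
  ractP : forall m a b,
    ract (ract m a) b - ract (ract m b) a = ract m (commutator a b) }.

Section Semidirect.
Variables (k : fieldType) (A : naAlgType k) (M : rmodule A).

(** Square-zero extension of A by M, with A acting on M from the right only.  It
serves twice: ungraded, to construct module maps out of pL(V); and with M in
degree 1, as a target for rpL(V). *)
Definition semidirect : Type := (A * M)%type.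
HB.instance Definition _ := GRing.Lmodule.on semidirect.

Implicit Types x y z : semidirect.
Definition semi_star x y : semidirect := (x.1 ⋆ y.1, ract x.2 y.1).

Fact semi_starDl : left_distributive semi_star +%R.
Proof. by move=> x y z; rewrite /semi_star /= starDl (linD (ract_linl _)). Qed.
Fact semi_starDr : right_distributive semi_star +%R.
Proof. by move=> x y z; rewrite /semi_star /= starDr (linD (ract_linr _)). Qed.
Fact semi_starZl (c : k) x y : semi_star (c *: x) y = c *: semi_star x y.
Proof. by rewrite /semi_star /= starZl (linZ (ract_linl _)). Qed.
Fact semi_starZr (c : k) x y : semi_star x (c *: y) = c *: semi_star x y.
Proof. by rewrite /semi_star /= starZr (linZ (ract_linr _)). Qed.
HB.instance Definition _ := Lmodule_isNonAssocAlgebra.Build k semidirect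
  semi_starDl semi_starDr semi_starZl semi_starZr.

Lemma semi_starE x y : x ⋆ y = (x.1 ⋆ y.1, ract x.2 y.1) :> semidirect.
Proof. by []. Qed.

Hypothesis plA : pre_Lie A.

(** The second component is the module axiom: both associators are
m·b·c - m·(b ⋆ c) with b and c exchanged. *)
Lemma semi_pre_Lie : pre_Lie semidirect.
Proof.
move=> x y z; rewrite /associator !semi_starE; congr (_, _) => /=; first exact: plA.
have := ractP x.2 y.1 z.1; rewrite /commutator (linB (ract_linr _)) => /eqP.
by rewrite subr_eq => /eqP ->; rewrite [LHS](ACl (3*2*1*4)) /= addrK.
Qed.

(** Stated by vanishing conditions, so that degrees at least 2 need no separate
case. *)
Definition semi_hom (n : nat) : set semidirect :=
  [set x | (n <> 0 -> x.1 = 0) /\ (n <> 1 -> x.2 = 0)].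

(** All signs are harmless: an associator whose second or third argument lies in M
vanishes, since M is never a right factor. *)
Lemma semi_graded : graded_pre_Lie semi_hom.
Proof.
have rl a := ract_linl (r := M) a; have rr m := ract_linr (r := M) m.
split.
- move=> n; split=> [|c x y [x1 x2] [y1 y2]]; first by [].
  by split=> nn /=; rewrite ?x1 ?y1 ?x2 ?y2 // scaler0 addr0.
- move=> S sS hS; apply/seteqP; split=> // x _.
  have -> : x = (x.1, 0) + (0, x.2) :> semidirect.
    by case: x => a m; congr (_, _); rewrite /= ?addr0 ?add0r.
  by apply: (submoduleD sS); [apply: (hS 0)|apply: (hS 1)].
- move=> m f hf f0 i im.
  have h2 (C : lmodType k) (p : semidirect -> C) (n : nat) : linear p ->
      (forall i, i <> n -> p (f i) = 0) -> (n < m)%N -> p (f n) = 0.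
    move=> pl pf nm; have := congr1 p f0; rewrite (lin0 pl) (lin_sum _ pl).
    rewrite (bigD1 (Ordinal nm)) //= big1 ?addr0 // => j.
    by rewrite -val_eqE => /eqP; exact: pf.
  have [p1 p2] : linear (fst : semidirect -> A) /\ linear (snd : semidirect -> M).
    by split.
  have f1 : (f i).1 = 0.
    have [i0|/eqP/(hf i).1//] := eqVneq i 0%N; move: im; rewrite i0.
    by apply: (h2 _ fst) => // j /(hf j).1.
  have f2 : (f i).2 = 0.
    have [i1|/eqP/(hf i).2//] := eqVneq i 1%N; move: im; rewrite i1.
    by apply: (h2 _ snd) => // j /(hf j).2.
  by rewrite [f i]surjective_pairing f1 f2.
- move=> i j x y [x1 x2] [y1 y2]; rewrite semi_starE; split=> /= ij.
    case: i j x1 x2 y1 y2 ij => [|i] [|j] // x1 x2 y1 y2 _.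
    + by rewrite y1 // star0r.
    + by rewrite x1 // star0l.
    + by rewrite x1 // star0l.
  case: j y1 y2 ij => [|j] y1 y2 ij; last by rewrite y1 // (lin0 (rr _)).
  by rewrite x2 ?(lin0 (rl _)) // => i1; apply: ij; rewrite i1.
move=> i j x y z [y1 y2] [z1 z2].
case: i y1 y2 => [|i] y1 y2; first case: j z1 z2 => [|j] z1 z2.
- by rewrite expr0 scale1r; exact: semi_pre_Lie.
- rewrite mul0n expr0 scale1r /associator !semi_starE /= z1 //.
  by rewrite !(star0l, star0r, lin0 (rr _), lin0 (rl _)).
- rewrite /associator !semi_starE /= y1 //.
  by rewrite !(star0l, star0r, lin0 (rr _), lin0 (rl _)) !subrr scaler0.
Qed.

End Semidirect.

(** * The free pre-Lie algebra as a free module *)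

Lemma pL_ind (k : fieldType) (V : lmodType k) (S : set (pL V)) : subspace S ->
  (forall v, S (pL_gen v)) -> (forall x y, S x -> S y -> S (x ⋆ y)) ->
  forall x, S x.
Proof.
move=> sS Sg Sm; elim/cls_ind; elim=> [|a Sa b Sb|c a Sa|v|[]|a Sa b Sb].
- exact: (sS.1).
- by rewrite clsD; apply: (subspaceD sS).
- by rewrite clsZ; apply: (subspaceZ sS).
- exact: Sg.
- by rewrite clsM; apply: Sm.
Qed.

Definition module_hom (k : fieldType) (A : naAlgType k) (M : rmodule A)
    (f : A -> M) : Prop :=
  linear f /\ forall a b, f (a ⋆ b) = ract (f a) b.

Definition module_closed (k : fieldType) (A : naAlgType k) (M : rmodule A)
    (T : set M) : Prop :=
  subspace T /\ forall m a, T m -> T (ract m a).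

Section FreeModule.
Variables (k : fieldType) (V : lmodType k).
Local Notation A := (pL V).

(** The congruence is needed because the maps compared by means of word expansions
respect the action only modulo a submodule. *)
Lemma hom_congr (M : rmodule A) (T : set M) (f g : A -> M) :
  module_closed T -> linear f -> linear g ->
  (forall a b, T (f (a ⋆ b) - ract (f a) b)) ->
  (forall a b, T (g (a ⋆ b) - ract (g a) b)) ->
  (forall v, T (f (pL_gen v) - g (pL_gen v))) ->
  forall x, T (f x - g x).
Proof.
move=> [sT aT] fl gl fm gm fg; apply: pL_ind => //.
  split=> [|c x y Tx Ty]; first by rewrite /= (lin0 fl) (lin0 gl) subr0; exact: sT.1.
  by rewrite /= fl gl opprD addrACA -scalerBr; exact: sT.2.
move=> a b /= Ta _; have := aT _ b Ta; rewrite (linB (ract_linl _)) => Tr.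
have := subspaceB sT (subspaceD sT (fm a b) Tr) (gm a b).
by rewrite addrA subrK opprB addrA subrK.
Qed.

Lemma module_hom_ext (M : rmodule A) (f g : A -> M) :
  module_hom f -> module_hom g ->
  (forall v, f (pL_gen v) = g (pL_gen v)) -> forall x, f x = g x.
Proof.
move=> [fl fm] [gl gm] fg x; apply/eqP; rewrite -subr_eq0; apply/eqP.
apply: (@hom_congr M [set 0]) => //=; rewrite /= => *.
- split=> [|m a ->]; last exact: (lin0 (ract_linl _)).
  by split=> //= c y z -> ->; rewrite scaler0 addr0.
- by rewrite fm subrr.
- by rewrite gm subrr.
- by rewrite fg subrr.
Qed.

Section Lift.
Variables (M : rmodule A) (f : V -> M).
Hypothesis fl : linear f.

Let semi_gen (v : V) : semidirect M := (pL_gen v, f v).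

Definition semi_lift : A -> semidirect M :=
  free_lift semi_gen (of_void (semidirect M)).

(** The free pre-Lie algebra is the free module on V: the graph of a module map
a |-> f a is a morphism of pre-Lie algebras a |-> (a, f a). *)
Definition module_lift (a : A) : M := (semi_lift a).2.

Let semi_gen_linear : linear semi_gen.
Proof. by move=> c v w; rewrite /semi_gen fl /pL_gen gen_linear. Qed.

Let semi_trivial := pre_Lie_graded (semi_pre_Lie (M := M) (@pL_pre_Lie k V)).

Lemma semi_liftE e : semi_lift (cls e) =
  evalE semi_gen (of_void (semidirect M)) e.
Proof. exact: (free_liftE semi_trivial semi_gen_linear). Qed.

Lemma semi_lift_morphism : alg_morphism semi_lift.
Proof. exact: (free_lift_morphism semi_trivial semi_gen_linear). Qed.

Lemma semi_lift_gen v : semi_lift (pL_gen v) = (pL_gen v, f v).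
Proof. exact: semi_liftE. Qed.

Lemma semi_lift_fst a : (semi_lift a).1 = a.
Proof.
have [sl sm] := semi_lift_morphism.
apply: (pL_ind (S := [set a | (semi_lift a).1 = a])).
- split=> [|c x y /= xE yE]; first by rewrite /= (lin0 sl).
  by rewrite /= sl /= xE yE.
- by move=> v; rewrite /= semi_lift_gen.
- by move=> x y /= xE yE; rewrite sm /= xE yE.
Qed.

Lemma module_lift_hom : module_hom module_lift.
Proof.
have [sl sm] := semi_lift_morphism; split=> [c x y|a b].
  by rewrite /module_lift sl.
by rewrite /module_lift sm semi_starE /= semi_lift_fst.
Qed.

Lemma module_lift_gen v : module_lift (pL_gen v) = f v.
Proof. by rewrite /module_lift semi_lift_gen. Qed.

End Lift.

(** The pre-Lie identity is exactly the module axiom for right multiplication. *)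
Definition regular : rmodule A.
Proof.
exists A (fun x a => x ⋆ a).
- by move=> a c x y; rewrite starDl starZl.
- by move=> a c x y; rewrite starDr starZr.
- move=> x a b; rewrite /commutator starBr.
  by rewrite (pre_Lie_swap (@pL_pre_Lie k V) x a b) addrC addKr.
Defined.

End FreeModule.

(** * The kernel of the differential, tested on modules *)

Section KernelAction.
Variables (k : fieldType) (V : lmodType k) (M : rmodule (pL V)) (m : M).
Local Notation A := (pL V).
Local Notation B := (semidirect M).

Let gen0 (v : V) : B := (pL_gen v, 0).
Let dum1 : B := (0, m).

Let to_semi : pLs V -> B :=
  free_lift gen0 (fun=> dum1).

Let semi_gr := semi_graded M (@pL_pre_Lie k V).
Let genl : linear gen0.
Proof. by move=> c v w; congr (_, _); rewrite /= ?scaler0 ?addr0 // /pL_gen gen_linear. Qed.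
Let genh v : semi_hom 0 (gen0 v). Proof. by []. Qed.
Let dumh (t : unit) : semi_hom 1 dum1. Proof. by []. Qed.

Let to_semiE e : to_semi (cls e) = evalE gen0 (fun=> dum1) e.
Proof. exact: (free_liftE semi_gr genl genh dumh). Qed.
Let to_semi_morphism : alg_morphism to_semi.
Proof. exact: (free_lift_morphism semi_gr genl genh dumh). Qed.

Let to_semi_ideal x :
  ideal_generated [set pLs_dummy V ⋆ pLs_dummy V] x -> to_semi x = 0.
Proof.
have [sl sm] := to_semi_morphism.
suff : ideal_generated [set pLs_dummy V ⋆ pLs_dummy V] `<=` [set x | to_semi x = 0].
  by apply.
apply: smallest_sub; last first.
  by move=> _ ->; rewrite /= sm !to_semiE /= semi_starE /= star0l (lin0 (ract_linr _)).
split; first split=> [|c y z /= y0 z0].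
- exact: (lin0 sl).
- by rewrite /= sl y0 z0 scaler0 addr0.
- by move=> y z /= y0; rewrite !sm y0 star0l star0r.
Qed.

(** Sends V to V and the dummy generator to m; it is well defined on the quotient
because two elements of M have product zero. *)
Definition rpL_to_semi (y : rpL V) : B := to_semi (repr y).

Let rpL_to_semiE z : rpL_to_semi (qproj _ z) = to_semi z.
Proof.
apply/eqP; rewrite -subr_eq0 -(linB to_semi_morphism.1); apply/eqP/to_semi_ideal.
exact: repr_proj.
Qed.

Lemma rpL_to_semi_morphism : alg_morphism rpL_to_semi.
Proof.
have [sl sm] := to_semi_morphism; split.
  move=> c; elim/qproj_ind=> x; elim/qproj_ind=> y.
  by rewrite -qprojZ -qprojD !rpL_to_semiE sl.
by elim/qproj_ind=> x; elim/qproj_ind=> y; rewrite -qprojM !rpL_to_semiE sm.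
Qed.

Lemma rpL_to_semi_dummy : rpL_to_semi (rpL_dummy V) = (0, m).
Proof. by rewrite rpL_to_semiE to_semiE. Qed.

Lemma rpL_to_semi_embed a : rpL_to_semi (embed a) = (a, 0).
Proof.
have [sl sm] := rpL_to_semi_morphism; have [el em] := embed_morphism V.
apply: (pL_ind (S := [set a | rpL_to_semi (embed a) = (a, 0)])).
- split=> [|c x y /= xE yE]; first by rewrite /= (lin0 el) (lin0 sl).
  by rewrite /= el sl xE yE; congr (_, _); rewrite /= scaler0 addr0.
- by move=> v; rewrite /= embed_gen rpL_to_semiE to_semiE.
- by move=> x y /= xE yE; rewrite em sm xE yE semi_starE /= (lin0 (ract_linl _)).
Qed.

(** On a product of elements of degree 0 the term a ⋆ d(b) has no component in M, and
Q contributes (m·a)·b - m·(a ⋆ b); so the M-component of d obeys the recursion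
of f a - m·a. *)
Lemma rpL_to_semi_d (f : A -> M) : module_hom f ->
  (forall v, f (pL_gen v) = ract m (pL_gen v)) ->
  forall a, (rpL_to_semi (rpL_d (embed a))).2 = f a - ract m a.
Proof.
move=> [fl fm] fg; have [dl _ dg _ dm] := rpL_dP V.
have [sl sm] := rpL_to_semi_morphism; have [el em] := embed_morphism V.
have h0 a : rpL_hom 0 (embed a) by rewrite -embed_range; exists a.
apply: (pL_ind (S := [set a | (rpL_to_semi (rpL_d (embed a))).2 = f a - ract m a])).
- split=> [|c x y /= xE yE].
    by rewrite /= (lin0 el) (lin0 dl) (lin0 sl) (lin0 fl) (lin0 (ract_linr _)) subr0.
  by rewrite /= el dl sl /= xE yE fl (ract_linr _) opprD addrACA scalerBr.
- by move=> v; rewrite /= embed_gen dg (lin0 sl) fg subrr.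
- move=> a b /= aE _; rewrite em (dm 0) // expr0 scale1r /rpL_Q -em.
  rewrite 2!(linD sl) (linB sl) !sm !rpL_to_semi_embed rpL_to_semi_dummy !semi_starE /=.
  rewrite aE fm (linB (ract_linl _)) (lin0 (ract_linl _)) addr0.
  by rewrite addrA subrK.
Qed.

End KernelAction.

(** In the enveloping algebra of the commutator Lie algebra this is the equation
x = v_1 X_1 + ... + v_r X_r for x = v_1{X_1} + ... + v_r{X_r}; quantifying over
all modules avoids constructing that algebra. *)
Definition action_determined (k : fieldType) (V : lmodType k) (x : pL V) : Prop :=
  forall (M : rmodule (pL V)) (m : M) (f : pL V -> M), module_hom f ->
  (forall v, f (pL_gen v) = ract m (pL_gen v)) -> f x = ract m x.

Lemma kernel_action_determined (k : fieldType) (V : lmodType k) (x : pL V) :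
  rpL_d (embed x) = 0 -> action_determined x.
Proof.
move=> dx M m f fh fg; apply/eqP; rewrite -subr_eq0; apply/eqP.
rewrite -(rpL_to_semi_d fh fg) dx.
by rewrite (lin0 (rpL_to_semi_morphism m).1).
Qed.

(** * Words *)

Section Convolution.
Variables (k : fieldType) (I : Type).
Implicit Types (g h : seq I -> k) (w : seq I).

(** The action of the tensor algebra on N-valued functions on words by
multiplication on the right: the sum over all factorizations w = u u' of
g u' *: f u. *)
Fixpoint conv (N : lmodType k) (f : seq I -> N) g w : N :=
  match w with
  | [::] => g [::] *: f [::]
  | i :: w' => g w *: f [::] + conv (fun u => f (i :: u)) g w'
  end.

Lemma conv_addl (N : lmodType k) (f f' : seq I -> N) g w :
  conv (fun u => f u + f' u) g w = conv f g w + conv f' g w.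
Proof.
elim: w f f' => [|i w IH] f f' /=; first by rewrite scalerDr.
by rewrite IH scalerDr addrACA.
Qed.

Lemma conv_linr (N : lmodType k) (f : seq I -> N) w c g h :
  conv f (fun u => c * g u + h u) w = c *: conv f g w + conv f h w.
Proof.
elim: w f => [|i w IH] f /=; first by rewrite scalerDl scalerA.
by rewrite IH scalerDl !scalerDr scalerA addrACA.
Qed.

Lemma conv_sub (N : lmodType k) (T : set N) (f : seq I -> N) g w :
  subspace T -> (forall u, T (f u)) -> T (conv f g w).
Proof.
move=> sT; elim: w f => [|i w IH] f Tf /=; first exact: (subspaceZ sT).
by apply: (subspaceD sT); [apply: (subspaceZ sT)|apply: IH].
Qed.

Lemma conv_map (N N' : lmodType k) (p : N -> N') (f : seq I -> N) g w :
  linear p -> conv (fun u => p (f u)) g w = p (conv f g w).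
Proof.
move=> pl; elim: w f => [|i w IH] f /=; first by rewrite (linZ pl).
by rewrite IH (linD pl) (linZ pl).
Qed.

Lemma convA (N : lmodType k) (f : seq I -> N) g h w :
  conv (conv f g) h w = conv f (conv (g : seq I -> k^o) h) w.
Proof.
elim: w f g => [|i w IH] f g /=; first by rewrite scalerA.
have mul_lin : linear (fun c : k^o => c *: f [::]).
  by move=> c x y; rewrite scalerDl scalerA.
rewrite conv_addl (conv_map (fun u => g (i :: u) : k^o) h w mul_lin) IH.
by rewrite addrA scalerA -scalerDl.
Qed.

(** Formal power series in noncommuting variables indexed by I; being associative,
they form a pre-Lie algebra. *)
Definition words : Type := seq I -> k.
HB.instance Definition _ := GRing.Lmodule.copy words (seq I -> k^o).

Lemma words_linE c (g h : words) w : (c *: g + h) w = c * g w + h w.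
Proof. by []. Qed.

Definition words_star (g h : words) : words := conv (g : seq I -> k^o) h.

Fact words_starDl : left_distributive words_star +%R.
Proof. by move=> f g h; apply/funext => w; exact: (conv_addl (f : seq I -> k^o) g). Qed.
Fact words_starDr : right_distributive words_star +%R.
Proof.
move=> f g h; apply/funext => w.
have E : g + h = (fun u => 1 * g u + h u) :> words.
  by apply/funext => u; rewrite mul1r.
by rewrite /words_star E conv_linr scale1r.
Qed.
Fact words_starZl c (f g : words) : words_star (c *: f) g = c *: words_star f g.
Proof.
apply/funext => w; apply: (conv_map (f : seq I -> k^o) g w (p := *:%R c)).
by move=> a x y; rewrite linearP.
Qed.
Fact words_starZr c (f g : words) : words_star f (c *: g) = c *: words_star f g.
Proof.
apply/funext => w.
have E : c *: g = (fun u => c * g u + 0) :> words by apply/funext => u; rewrite addr0.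
have E0 : conv (f : seq I -> k^o) (fun=> 0) w = 0.
  elim: w (f : seq I -> k^o) => [|i w IH] f' /=; first by rewrite scale0r.
  by rewrite IH scale0r addr0.
by rewrite /words_star E conv_linr E0 addr0.
Qed.
HB.instance Definition _ := Lmodule_isNonAssocAlgebra.Build k words
  words_starDl words_starDr words_starZl words_starZr.

Lemma words_pre_Lie : pre_Lie words.
Proof.
have words_starA (f g h : words) : f ⋆ g ⋆ h = f ⋆ (g ⋆ h).
  by apply/funext => w; exact: (convA (f : seq I -> k^o)).
by move=> f g h; rewrite /associator !words_starA !subrr.
Qed.

End Convolution.

Section Coefficients.
Variables (k : fieldType) (V : lmodType k) (I : Type) (coord : I -> V -> k).
Hypothesis coord_lin : forall i, linear (coord i : V -> k^o).
Local Notation A := (pL V).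

Definition letters (v : V) : words k I :=
  fun w => if w is [:: i] then coord i v else 0.

Let letters_lin : linear letters.
Proof.
move=> c v v'; apply/funext => w; rewrite words_linE.
by case: w => [|i [|j w]]; rewrite /= ?mulr0 ?addr0 //; exact: coord_lin.
Qed.

(** The coefficients of the pre-Lie morphism from pL(V) to the tensor algebra that
is the identity on V. *)
Definition coef : A -> words k I := free_lift letters (of_void (words k I)).

Let words_gr := pre_Lie_graded (@words_pre_Lie k I).

Lemma coef_morphism : alg_morphism coef.
Proof. exact: (free_lift_morphism words_gr letters_lin). Qed.

Lemma coef_gen v : coef (pL_gen v) = letters v.
Proof. exact: (free_liftE words_gr letters_lin). Qed.

Lemma coef_nil x : coef x [::] = 0.
Proof.
have [cl cm] := coef_morphism.
apply: (pL_ind (S := [set x | coef x [::] = 0])) => [|v|a b /= a0 _].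
- split=> [|c a b /= a0 b0]; first by rewrite /= (lin0 cl).
  by rewrite /= cl words_linE a0 b0 mulr0 addr0.
- by rewrite /= coef_gen.
- by rewrite cm /star/= /words_star /= a0 scaler0.
Qed.

(** The tensor product action: f is a formal sum of terms w ⊗ f w, and b acts on the
word through its image in the tensor algebra and on the coefficient by ⋆. *)
Definition words_act (f : seq I -> A) (b : A) : seq I -> A :=
  fun w => f w ⋆ b + conv f (coef b) w.

Fact words_act_linl b : linear (words_act^~ b).
Proof.
move=> c f f'; apply/funext => w; rewrite /words_act !fctE conv_addl.
rewrite starDl starZl (conv_map f (coef b) w (p := *:%R c)).
  by rewrite scalerDr addrACA.
by move=> a x y; rewrite linearP.
Qed.

Fact words_act_linr f : linear (words_act f).
Proof.
move=> c b b'; apply/funext => w; rewrite /words_act !fctE coef_morphism.1 conv_linr.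
by rewrite starDr starZr scalerDr addrACA.
Qed.

Fact words_actP f a b :
  words_act (words_act f a) b - words_act (words_act f b) a = words_act f (commutator a b).
Proof.
have [cl cm] := coef_morphism.
apply/funext => w; rewrite /words_act /= !fctE !conv_addl !starDl.
have star_lin d : linear (fun x : A => x ⋆ d) by move=> c x y; rewrite starDl starZl.
rewrite !(conv_map f _ w (star_lin _)) !convA.
have -> : coef (commutator a b) = (coef a ⋆ coef b) - (coef b ⋆ coef a).
  by rewrite /commutator (linB cl) !cm.
have /eqP := ractP (r := regular V) (f w) a b; rewrite /= subr_eq => /eqP ->.
have -> : coef a ⋆ coef b - coef b ⋆ coef a =
    (fun u => -1 * conv (coef b : seq I -> k^o) (coef a) u
              + conv (coef a : seq I -> k^o) (coef b) u).
  by apply/funext => u; rewrite mulN1r addrC.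
rewrite conv_linr scaleN1r !opprD !addrA.
by rewrite [LHS](ACl (1*9*5*2*6*3*8*4*7)) /= !addrK.
Qed.

Definition words_module : rmodule A :=
  RModule words_act_linl words_act_linr words_actP.

End Coefficients.

(** * Grafting, substituting and stripping roots *)

Section FiniteRank.
Variables (k : fieldType) (V : lmodType k).
Local Notation A := (pL V).
Local Notation gen := (@pL_gen k V).
Let star_linl (x : A) : linear (fun y : A => y ⋆ x).
Proof. exact: (ract_linl (r := regular V)). Qed.
Let star_linr (x : A) : linear (star x).
Proof. exact: (ract_linr (r := regular V)). Qed.

(** In trees, the span of the elements v{u X} with u and v in V, where u X is a product
in the enveloping algebra. *)
Definition gen_products : set A :=
  smallest (module_closed (M := regular V)) [set gen p.1 ⋆ gen p.2 | p in [set: V * V]].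

Definition left_normed : set A :=
  smallest (fun S => subspace S /\ forall x v, S x -> S (x ⋆ gen v)) (range gen).

Lemma gen_products_closed : module_closed (M := regular V) gen_products.
Proof.
split; first by apply: smallest_subspace => T [].
by move=> m a mT T TS; apply: TS.1.2; exact: mT.
Qed.

Lemma gen_products_gen u v : gen_products (gen u ⋆ gen v).
Proof. by apply: sub_gen_smallest; exists (u, v). Qed.

Lemma left_normed_subspace : subspace left_normed.
Proof. by apply: smallest_subspace => T []. Qed.

Lemma left_normed_gen v : left_normed (gen v).
Proof. by apply: sub_gen_smallest; exists v. Qed.

Lemma left_normed_star x v : left_normed x -> left_normed (x ⋆ gen v).
Proof. by move=> cx T TS; apply: TS.1.2; exact: cx. Qed.

(** For y = v_1{X_1} + ... this is u{v_1 X_1 + ...}, with products in the enveloping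
algebra. *)
Definition graft (u : V) : A -> A := module_lift (M := regular V) (fun v => gen u ⋆ gen v).

Let graft_gen_lin u : linear (fun v => gen u ⋆ gen v : regular V).
Proof. by move=> c v w; rewrite /pL_gen gen_linear star_linr. Qed.

Lemma graft_hom u : module_hom (M := regular V) (graft u).
Proof. exact: module_lift_hom. Qed.

Lemma graft_gen u v : graft u (gen v) = gen u ⋆ gen v.
Proof. exact: (module_lift_gen (graft_gen_lin u)). Qed.

Lemma graft_left_normed u y : left_normed y -> left_normed (graft u y).
Proof.
have [gl gm] := graft_hom u.
suff : left_normed `<=` [set y | left_normed (graft u y)] by apply.
apply: smallest_sub => [|_ [v _ <-]]; last first.
  by rewrite /= graft_gen; apply: left_normed_star; exact: left_normed_gen.
split=> [|x v /= cx]; last by rewrite gm; exact: left_normed_star.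
split=> [|c x x' /= cx cx']; first by rewrite /= (lin0 gl); exact: left_normed_subspace.1.
by rewrite /= gl; exact: left_normed_subspace.2.
Qed.

Lemma graft_gen_products u y : gen_products (graft u y).
Proof.
have [gl gm] := graft_hom u; have [s2 a2] := gen_products_closed.
apply: (pL_ind (S := [set y | gen_products (graft u y)])) => [|v|x b /= gx _].
- split=> [|c x x' /= cx cx']; first by rewrite /= (lin0 gl); exact: s2.1.
  by rewrite /= gl; exact: s2.2.
- by rewrite /= graft_gen; exact: gen_products_gen.
- by rewrite gm; exact: a2.
Qed.

Section Functional.
Variables (phi : V -> k).
Hypothesis phil : linear (phi : V -> k^o).

Let subst_fun (u : V) (v : V) : A := phi v *: gen u.

(** Replaces the root v of every tree by phi(v) u. *)
Definition subst (u : V) : A -> A := module_lift (M := regular V) (subst_fun u).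

Let subst_gen_lin u : linear (subst_fun u : V -> regular V).
Proof. by move=> c v w; rewrite /subst_fun phil scalerDl scalerA. Qed.

Lemma subst_hom u : module_hom (M := regular V) (subst u).
Proof. exact: module_lift_hom. Qed.

Lemma subst_gen u v : subst u (gen v) = phi v *: gen u.
Proof. exact: (module_lift_gen (subst_gen_lin u)). Qed.

Lemma subst_gen_products u x : gen_products x -> gen_products (subst u x).
Proof.
have [sl sm] := subst_hom u; have [s2 a2] := gen_products_closed.
suff : gen_products `<=` [set x | gen_products (subst u x)] by apply.
apply: smallest_sub => [|_ [[v v'] _ <-]]; last first.
  by rewrite /= sm subst_gen /= starZl; apply: (subspaceZ s2); exact: gen_products_gen.
split=> [|y b /= gy]; last by rewrite sm; exact: a2.
split=> [|c y y' /= gy gy']; first by rewrite /= (lin0 sl); exact: s2.1.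
by rewrite /= sl; exact: s2.2.
Qed.

(** The quotient of the enveloping algebra by the forests with at least two trees:
1·a = a and b·a = b ⋆ a. *)
Definition pointed : rmodule A.
Proof.
exists (k^o * A)%type (fun m a => (0, m.1 *: a + m.2 ⋆ a)).
- move=> a c m m'; congr (_, _); rewrite /= ?scaler0 ?addr0 //.
  by rewrite star_linl scalerDl scalerDr scalerA addrACA.
- move=> m c a b; congr (_, _); rewrite /= ?scaler0 ?addr0 //.
  by rewrite star_linr scalerDr !scalerDr !scalerA mulrC addrACA.
move=> m a b; congr (_, _); rewrite /= ?subr0 ?scale0r ?add0r //.
have /eqP := ractP (r := regular V) m.2 a b; rewrite /= subr_eq => /eqP.
rewrite !starDl !starZl => ->; rewrite scalerBr !opprD !addrA.
by rewrite [LHS](ACl (1*4*2*3*5)) /= addrK.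
Defined.

(** Sends v{X} to phi(v) times the part of the forest X with exactly one tree.  This
recovers y from [graft u y], and it removes one generator. *)
Definition strip : A -> A := fun x => (module_lift (M := pointed) (fun v => (phi v, 0)) x).2.

Let strip_gen_lin : linear (fun v => (phi v, 0) : pointed).
Proof. by move=> c v w; congr (_, _); rewrite /= ?phil ?scaler0 ?addr0. Qed.

Lemma strip_linear : linear strip.
Proof. by move=> c x y; rewrite /strip (module_lift_hom strip_gen_lin).1. Qed.

Lemma strip_gen v : strip (gen v) = 0.
Proof. by rewrite /strip (module_lift_gen strip_gen_lin). Qed.

Lemma strip_star x y :
  exists c : k, strip (x ⋆ y) = c *: y + strip x ⋆ y.
Proof.
by rewrite /strip (module_lift_hom strip_gen_lin).2; eexists; reflexivity.
Qed.

Lemma strip_graft u y : strip (graft u y) = phi u *: y.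
Proof.
have [ml mm] := module_lift_hom strip_gen_lin; have [gl gm] := graft_hom u.
set p := module_lift _ in ml mm.
suff : p (graft u y) = (0, phi u *: y) by rewrite /strip -/p => ->.
apply: (pL_ind (S := [set y | p (graft u y) = (0, phi u *: y)])) => [|v|x b /= xE _].
- split=> [|c x x' /= xE xE']; first by rewrite /= (lin0 gl) (lin0 ml) scaler0.
  rewrite /= gl ml xE xE'; congr (_, _); rewrite /= ?scaler0 ?addr0 //.
  by rewrite scalerDr !scalerA mulrC.
- rewrite /= graft_gen mm /p (module_lift_gen strip_gen_lin) /=.
  by rewrite star0l addr0.
- by rewrite gm mm xE /= scale0r add0r starZl.
Qed.

End Functional.
End FiniteRank.

(** * Weight *)

Section Weight.
Variables (k : fieldType) (V : lmodType k).
Local Notation A := (pL V).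

Fixpoint weight (e : expr V void) : nat :=
  match e with
  | Zero => 0
  | Add a b => maxn (weight a) (weight b)
  | Scale _ a => weight a
  | Gen _ => 1
  | Dum _ => 0
  | Mul a b => weight a + weight b
  end.

Definition weight_le (n : nat) (x : A) : Prop := exists2 e, (weight e <= n)%N & x = cls e.

Lemma weight_leW m n x : (m <= n)%N -> weight_le m x -> weight_le n x.
Proof. by move=> mn [e em ->]; exists e => //; exact: leq_trans mn. Qed.

Lemma weight_le_subspace n : subspace (weight_le n).
Proof.
split=> [|c _ _ [a an ->] [b bn ->]]; first by exists (Zero V void).
by exists (Add (Scale c a) b); rewrite /= ?geq_max ?an // clsD clsZ.
Qed.

Lemma weight_leM m n x y : weight_le m x -> weight_le n y -> weight_le (m + n) (x ⋆ y).
Proof. by move=> [a am ->] [b bn ->]; exists (Mul a b); rewrite ?clsM //= leq_add. Qed.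

Lemma weight0 e : weight e = 0%N -> cls e = 0.
Proof.
elim: e => [|a IHa b IHb|c a IHa|v|[]|a IHa b IHb] //=.
- move=> /eqP; rewrite -leqn0 geq_max !leqn0 => /andP[/eqP/IHa a0 /eqP/IHb b0].
  by rewrite clsD a0 b0 addr0.
- by move=> /IHa a0; rewrite clsZ a0 scaler0.
- by move=> /eqP; rewrite addn_eq0 => /andP[/eqP/IHa a0 _]; rewrite clsM a0 star0l.
Qed.

Lemma strip_weight (phi : V -> k) (phil : linear (phi : V -> k^o)) n (x : A) :
  weight_le n x -> weight_le n.-1 (strip phi x).
Proof.
have sl := strip_linear phil.
suff strip_e e : weight_le (weight e).-1 (strip phi (cls e)).
  move=> [e en ->]; apply: weight_leW (strip_e e).
  by rewrite -!subn1 leq_sub2r.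
have w0 m := (weight_le_subspace m).1.
elim: e => [|a IHa b IHb|c a IHa|v|[]|a IHa b IHb] /=.
- by rewrite cls0 (lin0 sl).
- rewrite clsD (linD sl); apply: (subspaceD (weight_le_subspace _)).
    by apply: weight_leW IHa; rewrite -!subn1 leq_sub2r // leq_maxl.
  by apply: weight_leW IHb; rewrite -!subn1 leq_sub2r // leq_maxr.
- by rewrite clsZ (linZ sl); apply: (subspaceZ (weight_le_subspace _)).
- by rewrite strip_gen.
rewrite clsM; have [a0|a_gt0] := posnP (weight a).
  by rewrite (weight0 a0) star0l (lin0 sl).
have [c ->] := strip_star phil (cls a) (cls b).
apply: (subspaceD (weight_le_subspace _)).
  apply: (subspaceZ (weight_le_subspace _)); exists b => //.
  by rewrite -(prednK a_gt0) addSn leq_addl.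
rewrite -(prednK a_gt0) addSn; apply: (@weight_leM _ (weight b)) => //.
by exists b.
Qed.

End Weight.

(** * Kernel elements are left-normed *)

Section FiniteRank.
Variables (k : fieldType) (V : lmodType k) (I : finType).
Variables (e : I -> V) (phi : I -> V -> k).
Hypothesis phil : forall i, linear (phi i : V -> k^o).
Hypothesis phi_e : forall i j, phi i (e j) = (i == j)%:R.
Hypothesis e_phi : forall v, v = \sum_i phi i v *: e i.
Local Notation A := (pL V).
Local Notation gen := (@pL_gen k V).
Local Notation coef := (coef phi).
Local Notation W := (words_module phil).

Let gl : linear gen. Proof. exact: gen_linear. Qed.
Let gen_sum v : gen v = \sum_i phi i v *: gen (e i).
Proof.
by rewrite [in LHS](e_phi v) (lin_sum _ gl); apply: eq_bigr => i _; rewrite (linZ gl).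
Qed.

Let star_sum (f : I -> A) b : (\sum_i f i) ⋆ b = \sum_i f i ⋆ b.
Proof. exact: (lin_sum f (ract_linl (r := regular V) b)). Qed.

Definition at_nil (x : A) : seq I -> A := fun w => if w is [::] then x else 0.

Let at_nil_gen_lin : linear (fun v => at_nil (gen v) : W).
Proof. by move=> c v w; apply/funext => -[|i u]; rewrite /= !fctE /= ?gl // scaler0 addr0. Qed.

(** The module map v{X} |-> v·X, starting from v placed on the empty word.  Its value
on a word w is v{X'} summed over the coproduct X', X'' of X, weighted by the
coefficient of w in the image of X'' in the tensor algebra. *)
Definition expansion : A -> W := module_lift (fun v => at_nil (gen v) : W).

Lemma expansion_hom : module_hom expansion.
Proof. exact: module_lift_hom. Qed.

Lemma expansion_gen v : expansion (gen v) = at_nil (gen v).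
Proof. exact: (module_lift_gen at_nil_gen_lin). Qed.

Let ract_nil (f : W) b : ract f b [::] = f [::] ⋆ b.
Proof. by rewrite /= /words_act /= coef_nil // scale0r addr0. Qed.

Definition shift i (f : seq I -> A) : seq I -> A := fun u => f (i :: u).

Let ract_cons (f : W) b i w : ract f b (i :: w) =
  coef b (i :: w) *: f [::] + ract (shift i f : W) b w.
Proof. by rewrite /= /words_act /= addrCA. Qed.

Let ract_at_nil x b w : ract (at_nil x : W) b w =
  coef b w *: x + (if w is [::] then x ⋆ b else 0).
Proof.
case: w => [|i w]; first by rewrite ract_nil coef_nil // scale0r add0r.
by rewrite ract_cons -[shift _ _]/(0 : W) (lin0 (ract_linl b)).
Qed.

Lemma expansion_nil x : expansion x [::] = x.
Proof.
have [sl sm] := expansion_hom.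
apply: (pL_ind (S := [set x | expansion x [::] = x])) => [|v|a b /= aE _].
- split=> [|c a b /= aE bE]; first by rewrite /= (lin0 sl).
  by rewrite /= sl !fctE aE bE.
- by rewrite /= expansion_gen.
- by rewrite sm ract_nil aE.
Qed.

Let gen_products_words : module_closed [set f : W | forall w, gen_products (f w)].
Proof.
have [s2 a2] := gen_products_closed V; split=> [|f b /= gf w].
  by split=> [w|c f g /= gf gg w]; [exact: s2.1|apply: s2.2].
by apply: (subspaceD s2); [apply: a2|apply: conv_sub].
Qed.

Definition gen_mod_products (x : A) : Prop := exists v, gen_products (x - gen v).

Lemma gen_mod_products_subspace : subspace gen_mod_products.
Proof.
have [s2 a2] := gen_products_closed V; split=> [|c x y [v xv] [w yw]].
  by exists 0; rewrite (lin0 gl) subr0; exact: s2.1.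
by exists (c *: v + w); rewrite gl opprD addrACA -scalerBr; exact: s2.2.
Qed.

Lemma gen_mod_productsW x y :
  gen_products (x - y) -> gen_mod_products y -> gen_mod_products x.
Proof.
move=> xy [v yv]; exists v; have := subspaceD (gen_products_closed V).1 xy yv.
by rewrite addrA subrK.
Qed.

Lemma subst_gen_mod_products i u x :
  gen_mod_products x -> gen_mod_products (subst (phi i) u x).
Proof.
move=> [v xv]; exists (phi i v *: u); rewrite (linZ gl) -(subst_gen (phil i)).
rewrite -(linB (subst_hom (phil i) u).1).
exact: subst_gen_products.
Qed.

(** An element is the sum of its coordinate parts, and substituting e_i for
the root through the i-th coordinate extracts such a part. *)
Lemma gen_mod_products_subst x :
  (forall i, gen_mod_products (subst (phi i) (e i) x)) -> gen_mod_products x.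
Proof.
move=> xi; have -> : x = \sum_i subst (phi i) (e i) x.
  pose f x := \sum_i subst (phi i) (e i) x.
  have sh i := subst_hom (phil i) (e i).
  apply: (@module_hom_ext _ _ (regular V) id f) => [//||v].
    split=> [c a b|a b]; rewrite /f.
      by rewrite scaler_sumr -big_split; apply: eq_bigr => i _; rewrite (sh i).1.
    by rewrite /= star_sum; apply: eq_bigr => i _; rewrite (sh i).2.
  rewrite /= /f [LHS]gen_sum; apply: eq_bigr => i _.
  by rewrite (subst_gen (phil i)).
exact: (subspace_sum gen_mod_products_subspace).
Qed.

Let conv_sum (f : I -> seq I -> A) (g : seq I -> k) w :
  conv (fun u => \sum_i f i u) g w = \sum_i conv (f i) g w.
Proof.
elim: w f => [|j w IH] f /=; first by rewrite scaler_sumr.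
by rewrite (IH (fun i u => f i (j :: u))) scaler_sumr big_split.
Qed.

(** Test x on the vectors m_i = e_i placed on the empty word.  Modulo gen_products, the
value of the resulting module maps on the word i w, summed over i, is the expansion
at w, since m_i·v takes the value phi_j(v) e_i on the one-letter
word j and a value in gen_products on the empty word.  On the other hand m_i·x is a
multiple of e_i on every nonempty word. *)
Lemma expansion_kernel x :
  action_determined x -> forall w, gen_mod_products (expansion x w).
Proof.
move=> xdet w; have [s2 a2] := gen_products_closed V.
pose m i : W := at_nil (gen (e i)).
have ml i : linear (fun v => ract (m i) (gen v)).
  by move=> c u v; rewrite gl (ract_linr (m i)).
pose f i : A -> W := module_lift (fun v => ract (m i) (gen v)).
have fh i : module_hom (f i) by exact: module_lift_hom (ml i).
have fl i := (fh i).1; have fm i := (fh i).2.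
have fg i v : f i (gen v) = ract (m i) (gen v) by exact: (module_lift_gen (ml i)).
have f_nil i a : gen_products (f i a [::]).
  apply: (pL_ind (S := [set a | gen_products (f i a [::])])) => [|v|b c /= fb _].
  - split=> [|c b b' /= gb gb']; first by rewrite /= (lin0 (fl i)); exact: s2.1.
    by rewrite /= fl; exact: s2.2.
  - by rewrite /= fg ract_at_nil coef_nil // scale0r add0r; exact: gen_products_gen.
  - by rewrite fm ract_nil; exact: a2.
pose g a : W := fun w => \sum_i f i a (i :: w).
have : gen_products (expansion x w - g x w).
  have gE b (h : W) u : ract h b u = h u ⋆ b + conv h (coef b) u by [].
  apply: (@hom_congr _ _ W [set h : W | forall w, gen_products (h w)] expansion g) => //.
  - exact: expansion_hom.1.
  - move=> c a b; apply/funext => u; rewrite /g !fctE scaler_sumr -big_split /=.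
    by apply: eq_bigr => i _; rewrite fl.
  - by move=> a b u; rewrite expansion_hom.2 subrr; exact: s2.1.
  - move=> a b u; rewrite -[X in gen_products X]/(g (a ⋆ b) u - ract (g a) b u) gE /g.
    rewrite conv_sum star_sum -big_split -sumrB.
    apply: (subspace_sum s2) => i; rewrite fm ract_cons gE addrK.
    exact: (subspaceZ s2).
  - move=> v u; rewrite -[X in gen_products X]/(expansion (gen v) u - g (gen v) u).
    rewrite expansion_gen /g; under eq_bigr => i _ do rewrite fg ract_at_nil coef_gen // addr0.
    case: u => [|j u] /=; first by rewrite -gen_sum subrr; exact: s2.1.
    by rewrite big1 ?subr0 => [|i _]; [exact: s2.1|rewrite scale0r].
move=> /gen_mod_productsW; apply; exists (\sum_i coef x (i :: w) *: e i).
rewrite (lin_sum _ gl) /g -sumrB; apply: (subspace_sum s2) => i.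
rewrite (xdet W (m i) (f i)) //.
by rewrite ract_at_nil addr0 (linZ gl) subrr; exact: s2.1.
Qed.

Lemma subst_subst i j u v x :
  subst (phi i) u (subst (phi j) v x) = phi i v *: subst (phi j) u x.
Proof.
have [il im] := subst_hom (phil i) u; have [jl jm] := subst_hom (phil j) v.
have [ul um] := subst_hom (phil j) u.
apply: (@module_hom_ext _ _ (regular V) (fun x => subst (phi i) u (subst (phi j) v x))
  (fun x => phi i v *: subst (phi j) u x)) => [||v' /=].
- by split=> [c a b|a b]; rewrite ?jl ?il // jm im.
- split=> [c a b|a b]; first by rewrite ul scalerDr !scalerA mulrC.
  by rewrite um /= starZl.
by rewrite !subst_gen // (linZ il) subst_gen // !scalerA mulrC.
Qed.

(** Let y = v_1{X_1}, so that graft u y = u{v_1 X_1}.  The coproduct sends the primitive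
factor v_1 either to the word, as its first letter, or to the tree, where it gives an
element u{v_1 X} of gen_products. *)
Lemma expansion_graft u y j w :
  gen_products (expansion (graft u y) (j :: w) - subst (phi j) u (expansion y w)).
Proof.
have [s2 a2] := gen_products_closed V; have [sl sm] := subst_hom (phil j) u.
have [pl pm] := expansion_hom; have [rl rm] := graft_hom u.
pose f y : W := fun w => expansion (graft u y) (j :: w).
pose g y : W := fun w => subst (phi j) u (expansion y w).
apply: (@hom_congr _ _ W [set h : W | forall w, gen_products (h w)] f g) => //.
- by move=> c a b; rewrite /f rl pl.
- by move=> c a b; apply/funext => v; rewrite /g pl !fctE sl.
- move=> a b v; rewrite -[X in gen_products X]/(f (a ⋆ b) v - ract (f a) b v) /f rm pm ract_cons.
  by rewrite addrK expansion_nil; apply: (subspaceZ s2); exact: graft_gen_products.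
- move=> a b v; rewrite -[X in gen_products X]/(g (a ⋆ b) v - ract (g a) b v) /g pm /=.
  rewrite /words_act (linD sl) sm (conv_map _ _ _ sl) subrr; exact: s2.1.
- move=> v [|i t]; rewrite -[X in gen_products X]/(f (gen v) _ - g (gen v) _) /f /g graft_gen;
    rewrite pm !expansion_gen ract_at_nil coef_gen // addr0 /=.
    by rewrite (subst_gen (phil j)) subrr; exact: s2.1.
  by rewrite scale0r (lin0 sl) subr0; exact: s2.1.
Qed.

Lemma gen_products_grafts x :
  gen_products x -> exists y : I -> A, x = \sum_i graft (e i) (y i).
Proof.
have rh i := graft_hom (e i).
suff : @gen_products k V `<=` [set x | exists y : I -> A, x = \sum_i graft (e i) (y i)] by apply.
apply: smallest_sub => [|_ [[u v] _ <-]] /=; last first.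
  exists (fun i => phi i u *: gen v); rewrite [in LHS]gen_sum.
  rewrite star_sum; apply: eq_bigr => i _ /=.
  by rewrite starZl (linZ (rh i).1) graft_gen.
split=> [|_ b [y ->]]; last first.
  exists (fun i => y i ⋆ b); rewrite /= star_sum.
  by apply: eq_bigr => i _; rewrite (rh i).2.
split=> [|c _ _ [y ->] [z ->]].
  by exists (fun=> 0); rewrite big1 // => i _; rewrite (lin0 (rh i).1).
exists (fun i => c *: y i + z i); rewrite scaler_sumr -big_split.
by apply: eq_bigr => i _; rewrite (rh i).1.
Qed.

(** The value of the expansion on the empty word is x, so x is a generator plus a sum
of elements graft (e i) (y i); the values on words j w pass the hypothesis to each
y i, which has smaller weight. *)
Lemma expansion_left_normed n x :
  weight_le n x -> (forall w, gen_mod_products (expansion x w)) -> left_normed x.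
Proof.
elim: n x => [|n IH] x xn xP.
  case: xn => f; rewrite leqn0 => /eqP/weight0 -> ->; exact: (left_normed_subspace V).1.
have [pl pm] := expansion_hom.
have [v /gen_products_grafts[y xv]] := xP [::]; move: xv; rewrite expansion_nil => xv.
have {}xv : x = gen v + \sum_i graft (e i) (y i) by rewrite -xv addrC subrK.
rewrite xv; apply: (subspaceD (left_normed_subspace V)); first exact: left_normed_gen.
apply: (subspace_sum (left_normed_subspace V)) => i; apply: graft_left_normed; apply: IH.
  (* Stripping shows that y i is determined by x and has smaller weight. *)
  have -> : y i = strip (phi i) x.
    have tl := strip_linear (phil i).
    rewrite xv (linD tl) (strip_gen (phil i)) add0r (lin_sum _ tl) (bigD1 i) //=.
    rewrite (strip_graft (phil i)) phi_e eqxx scale1r big1 ?addr0 // => j ij.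
    by rewrite (strip_graft (phil i)) phi_e eq_sym (negPf ij) scale0r.
  exact: (strip_weight (phil i) xn).
move=> w; apply: gen_mod_products_subst => j.
have s2 := (gen_products_closed V).1; have [tl tm] := subst_hom (phil i) (e j).
apply: gen_mod_productsW (subst_gen_mod_products i (e j) (xP (j :: w))).
(* Since phi i (e l) vanishes for l distinct from i, substituting through phi i
   isolates y i. *)
pose z l := expansion (graft (e l) (y l)) (j :: w).
have -> : expansion x (j :: w) = \sum_l z l.
  rewrite xv (linD pl) expansion_gen (lin_sum _ pl) fctE /= add0r.
  by rewrite (big_morph (fun f : W => f (j :: w)) (id1 := 0) (op1 := +%R)).
have -> : subst (phi j) (e j) (expansion (y i) w) =
    \sum_l subst (phi i) (e j) (subst (phi j) (e l) (expansion (y l) w)).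
  rewrite (bigD1 i) //= subst_subst phi_e eqxx scale1r big1 ?addr0 // => l il.
  by rewrite subst_subst phi_e eq_sym (negPf il) scale0r.
rewrite (lin_sum _ tl) -sumrB; apply: (subspace_sum s2) => l.
rewrite -(linB tl); apply: subst_gen_products => //.
by rewrite -opprB -scaleN1r; apply: (subspaceZ s2); exact: expansion_graft.
Qed.

End FiniteRank.

(** * The Euler derivation *)

Section DualNumbers.
Variables (k : fieldType) (A : naAlgType k).

(** Derivations of A are the sections of dual_numbers A; hence a linear map on V
extends to a derivation of pL(V). *)
Definition dual_numbers : Type := (A * A)%type.
HB.instance Definition _ := GRing.Lmodule.on dual_numbers.

Implicit Types x y z : dual_numbers.
Definition dual_star x y : dual_numbers := (x.1 ⋆ y.1, x.2 ⋆ y.1 + x.1 ⋆ y.2).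

Fact dual_starDl : left_distributive dual_star +%R.
Proof. by move=> x y z; rewrite /dual_star /= !starDl addrACA. Qed.
Fact dual_starDr : right_distributive dual_star +%R.
Proof. by move=> x y z; rewrite /dual_star /= !starDr addrACA. Qed.
Fact dual_starZl (c : k) x y : dual_star (c *: x) y = c *: dual_star x y.
Proof. by rewrite /dual_star /= !starZl -scalerDr. Qed.
Fact dual_starZr (c : k) x y : dual_star x (c *: y) = c *: dual_star x y.
Proof. by rewrite /dual_star /= !starZr -scalerDr. Qed.
HB.instance Definition _ := Lmodule_isNonAssocAlgebra.Build k dual_numbers
  dual_starDl dual_starDr dual_starZl dual_starZr.

Lemma dual_starE x y : x ⋆ y = (x.1 ⋆ y.1, x.2 ⋆ y.1 + x.1 ⋆ y.2) :> dual_numbers.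
Proof. by []. Qed.

Lemma dual_pre_Lie : pre_Lie A -> pre_Lie dual_numbers.
Proof.
move=> pl x y z.
have assocE u v w : associator u v w = (associator u.1 v.1 w.1,
    associator u.2 v.1 w.1 + associator u.1 v.2 w.1 + associator u.1 v.1 w.2)
    :> dual_numbers.
  rewrite /associator !dual_starE; congr (_, _); rewrite /= !starDl !starDr !opprD !addrA.
  by rewrite [LHS](ACl (1*4*2*5*3*6)).
by rewrite !assocE (pl x.1) (pl x.2) (pl x.1 y.2) (pl x.1 y.1 z.2) addrAC.
Qed.

End DualNumbers.

Section Euler.
Variables (k : fieldType) (V : lmodType k).
Local Notation A := (pL V).
Local Notation gen := (@pL_gen k V).

Let dual_gen (v : V) : dual_numbers A := (gen v, gen v).
Let dual_lift : A -> dual_numbers A := free_lift dual_gen (of_void (dual_numbers A)).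
Definition euler (x : A) : A := (dual_lift x).2.

Let dual_gr := pre_Lie_graded (dual_pre_Lie (@pL_pre_Lie k V)).
Let dual_gen_lin : linear dual_gen.
Proof. by move=> c v w; rewrite /dual_gen /pL_gen gen_linear. Qed.
Let dual_morphism : alg_morphism dual_lift.
Proof. exact: (free_lift_morphism dual_gr dual_gen_lin). Qed.
Let dual_lift_gen v : dual_lift (gen v) = dual_gen v.
Proof. exact: (free_liftE dual_gr dual_gen_lin). Qed.

Let dual_fst x : (dual_lift x).1 = x.
Proof.
have [dl dm] := dual_morphism.
apply: (pL_ind (S := [set x | (dual_lift x).1 = x])).
- split=> [|c a b /= aE bE]; first by rewrite /= (lin0 dl).
  by rewrite /= dl /= aE bE.
- by move=> v; rewrite /= dual_lift_gen.
- by move=> a b /= aE bE; rewrite dm /= aE bE.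
Qed.

Lemma euler_linear : linear euler.
Proof. by move=> c x y; rewrite /euler dual_morphism.1. Qed.

Lemma euler_gen v : euler (gen v) = gen v.
Proof. by rewrite /euler dual_lift_gen. Qed.

Lemma euler_star x y : euler (x ⋆ y) = euler x ⋆ y + x ⋆ euler y.
Proof. by rewrite /euler dual_morphism.2 dual_starE /= !dual_fst. Qed.

Lemma euler_commutator x y :
  euler (commutator x y) = commutator (euler x) y - commutator (euler y) x.
Proof.
rewrite /commutator (linB euler_linear) !euler_star opprB !opprD !addrA.
by rewrite [LHS](ACl (1*4*2*3)) /=.
Qed.

(** Products of eigenvectors of a derivation are eigenvectors, and eigenvalues add. *)
Lemma euler_eigen x : exists2 s : seq A,
  forall y, y \in s -> exists2 n, (n > 0)%N & euler y = n%:R *: y &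
  x = \sum_(y <- s) y.
Proof.
have el := euler_linear.
apply: (pL_ind (S := [set x | exists2 s : seq A,
  forall y, y \in s -> exists2 n, (n > 0)%N & euler y = n%:R *: y &
  x = \sum_(y <- s) y])) => [|v|_ _ [s hs ->] [t ht ->]].
- split=> [|c _ _ [s hs ->] [t ht ->]]; first by exists [::]; rewrite ?big_nil.
  exists ([seq c *: y | y <- s] ++ t) => [y|]; last first.
    by rewrite big_cat big_map scaler_sumr.
  rewrite mem_cat => /orP[/mapP[z /hs[n n0 zn] ->]|/ht//].
  by exists n => //; rewrite (linZ el) zn !scalerA mulrC.
- exists [:: gen v]; last by rewrite big_seq1.
  by move=> y; rewrite inE => /eqP ->; exists 1%N; rewrite // euler_gen scale1r.
exists [seq y ⋆ z | y <- s, z <- t].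
  move=> _ /allpairsP[[y z] /= [/hs[m m0 ym] /ht[n n0 zn] ->]].
  exists (m + n)%N; first by rewrite addn_gt0 m0.
  by rewrite euler_star ym zn starZl starZr -scalerDl natrD.
have suml (r : seq A) b : (\sum_(y <- r) y) ⋆ b = \sum_(y <- r) (y ⋆ b).
  by apply: (big_morph (fun y : A => y ⋆ b)) => [y z|]; rewrite ?starDl ?star0l.
have sumr a (r : seq A) : a ⋆ (\sum_(y <- r) y) = \sum_(y <- r) (a ⋆ y).
  by apply: (big_morph (fun y : A => a ⋆ y)) => [y z|]; rewrite ?starDr ?star0r.
rewrite suml big_allpairs_dep; apply: eq_bigr => y _; exact: sumr.
Qed.

(** Induction on the number of eigenvectors that sum to x: applying E - n for one of the
eigenvalues n removes an eigenvector, and n x is E(x) minus the element so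
obtained. *)
Lemma euler_descent (S : set A) : [pchar k] =i pred0 -> subspace S ->
  (forall x, S x -> S (euler x)) -> forall x, S (euler x) -> S x.
Proof.
move=> /pcharf0P char0 sS eS x; have el := euler_linear.
have [s hs ->] := euler_eigen x.
have [m sm] := ubnP (size s); elim: m s hs sm => // m IH [|y s] hs sm Sx.
  by rewrite big_nil; exact: sS.1.
have [n n_gt0 yn] := hs y (mem_head _ _).
set z := \sum_(_ <- _) _ in Sx *.
have n0 : n%:R != 0 :> k by rewrite char0 -lt0n.
have Sz' : S (euler z - n%:R *: z).
  pose t := [seq euler u - n%:R *: u | u <- s].
  have zt : euler z - n%:R *: z = \sum_(u <- t) u.
    rewrite big_map sumrB -(big_morph _ (linD el) (lin0 el)) -scaler_sumr.
    by rewrite /z big_cons (linD el) yn scalerDr opprD addrACA subrr add0r.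
  rewrite zt; apply: IH.
  - move=> _ /mapP[u us ->].
    have [|p p0 up] := hs u; first by rewrite inE us orbT.
    exists p => //; rewrite (linB el) (linZ el) up (linZ el) up.
    by rewrite scalerBr !scalerA [n%:R * _]mulrC.
  - by rewrite size_map.
  - rewrite -zt (linB el) (linZ el); apply: (subspaceB sS); first exact: eS.
    exact: (subspaceZ sS).
have := subspaceZ sS n%:R^-1 (subspaceB sS Sx Sz').
by rewrite opprB addrC subrK scalerA mulVf // scale1r.
Qed.

End Euler.

(** * Lie elements *)

Section LieElements.
Variables (k : fieldType) (V : lmodType k).
Local Notation A := (pL V).
Local Notation gen := (@pL_gen k V).

Lemma Lie_elements_subalgebra : Lie_subalgebra (Lie_elements V).
Proof.
split; first by apply: smallest_subspace => T [].
by move=> x y Lx Ly T TS; apply: TS.1.2; [exact: Lx|exact: Ly].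
Qed.

Lemma Lie_elements_gen v : Lie_elements V (gen v).
Proof. by apply: sub_gen_smallest; exists v. Qed.

Lemma Lie_elements_euler x : Lie_elements V x -> Lie_elements V (euler x).
Proof.
have [sL cL] := Lie_elements_subalgebra; have el := @euler_linear k V.
move=> Lx; suff : Lie_elements V `<=` [set x | Lie_elements V x /\ Lie_elements V (euler x)].
  by move=> /(_ x Lx) [].
apply: smallest_sub => [|_ [v _ <-]]; last first.
  by rewrite /= euler_gen; split; exact: Lie_elements_gen.
split=> [|y z /= [Ly Ley] [Lz Lez]]; last first.
  split; first exact: cL.
  by rewrite euler_commutator; apply: (subspaceB sL); exact: cL.
split=> [|c y z /= [Ly Ley] [Lz Lez]]; first by rewrite /= (lin0 el); split; exact: sL.1.
by rewrite /= el; split; exact: sL.2.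
Qed.

Let comm_linl (b : A) : linear (fun a : A => commutator a b).
Proof.
move=> c a a'; rewrite /commutator starDl starZl starDr starZr.
by rewrite opprD addrACA scalerBr.
Qed.
Let comm_linr (a : A) : linear (commutator a).
Proof.
move=> c b b'; rewrite /commutator starDl starZl starDr starZr.
by rewrite opprD addrACA scalerBr.
Qed.

(** The axiom for the vector 1 says that a |-> E(a) is a cocycle with values in the
adjoint module, which holds for every derivation. *)
Definition euler_module : rmodule A.
Proof.
exists (k^o * A)%type (fun m b => (0, commutator m.2 b + (m.1 : k) *: euler b)).
- move=> b c m m'; congr (_, _); rewrite /= ?scaler0 ?addr0 // comm_linl.
  move: (commutator m.2 b) (commutator m'.2 b) => p q.
  by rewrite scalerDl scalerDr scalerA addrACA.
- move=> m c a b; congr (_, _); rewrite /= ?scaler0 ?addr0 // comm_linr.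
  move: (commutator m.2 a) (commutator m.2 b) => p q.
  by rewrite euler_linear !scalerDr !scalerA mulrC addrACA.
move=> m a b; congr (_, _); rewrite /= ?subr0 // !scale0r !addr0.
rewrite (linD (comm_linl b)) (linZ (comm_linl b)) (linD (comm_linl a)).
rewrite (linZ (comm_linl a)) euler_commutator -(commutator_Jacobi (@pL_pre_Lie k V)).
move: (commutator (commutator _ _) _) (commutator (commutator _ _) _) => p q.
move: (commutator _ _) (commutator _ _) => r s.
by rewrite scalerBr opprD !addrA [LHS](ACl (1*3*2*4)).
Defined.

(** For m = (1, 0) one has m·x = (0, E(x)), while the module map with v |-> (0, v) turns a
left-normed product into the left-normed bracket of the same generators. *)
Lemma left_normed_Lie_euler x :
  action_determined x -> left_normed x -> Lie_elements V (euler x).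
Proof.
move=> xdet cx; have [sL cL] := Lie_elements_subalgebra.
pose m : euler_module := (1, 0).
have mE b : ract m b = (0, euler b).
  by rewrite /= scale1r /commutator star0l star0r subrr add0r.
have ml : linear (fun v => ract m (gen v)).
  by move=> c u v; rewrite /pL_gen gen_linear (ract_linr m).
pose f := module_lift (fun v => ract m (gen v)).
have fh : module_hom f by exact: module_lift_hom ml.
have fg v : f (gen v) = ract m (gen v) by exact: (module_lift_gen ml).
have -> : euler x = (f x).2 by rewrite (xdet _ m f) // mE.
suff : @left_normed k V `<=` [set x | (f x).1 = 0 /\ Lie_elements V (f x).2].
  by move=> /(_ x cx) [].
apply: smallest_sub => [|_ [v _ <-]]; last first.
  by rewrite /= fg mE euler_gen; split=> //; exact: Lie_elements_gen.
split=> [|y v /= [y1 y2]].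
  split=> [|c y z /= [y1 y2] [z1 z2]].
    by rewrite /= (lin0 fh.1); split=> //; exact: sL.1.
  by rewrite /= fh.1 /= y1 z1 scaler0 addr0; split=> //; exact: sL.2.
rewrite fh.2 /= y1 scale0r addr0; split=> //.
by apply: cL => //; exact: Lie_elements_gen.
Qed.

Lemma Lie_elements_kernel x : Lie_elements V x -> rpL_d (embed x) = 0.
Proof.
have [dl _ dg _ dm] := rpL_dP V; have [el em] := embed_morphism V.
have h0 (a : A) : rpL_hom 0 (embed a) by rewrite -embed_range; exists a.
suff : Lie_elements V `<=` [set x | rpL_d (embed x) = 0] by apply.
apply: smallest_sub => [|_ [v _ <-]]; last by rewrite /= embed_gen dg.
split=> [|a b /= da db].
  split=> [|c a b /= da db]; first by rewrite /= (lin0 el) (lin0 dl).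
  by rewrite /= el dl da db scaler0 addr0.
have Q_sym : rpL_Q (embed a) (embed b) = rpL_Q (embed b) (embed a).
  by have := hom_pre_Lie (rpL_graded V) (rpL_dummy V) (h0 a) (h0 b); rewrite scale1r.
rewrite /commutator (linB el) !em (linB dl) !(dm 0%N) // da db !(star0l, star0r).
by rewrite scaler0 !add0r Q_sym subrr.
Qed.

End LieElements.

(** * Reduction to finite rank *)

Section Functionals.
Variables (k : fieldType) (V : lmodType k).

(** A subspace maximal among those avoiding w is a hyperplane complementary to the
line through w; the functional is the coordinate along that line. *)
Lemma separating_functional (w : V) : w != 0 ->
  exists2 phi : V -> k, linear (phi : V -> k^o) & phi w = 1.
Proof.
(* The empty union of a chain is the empty set, which is no subspace; hence its
   separate mention in P. *)
move=> w0; pose P : set (set V) := [set S | ~ S w /\ (S = set0 \/ subspace S)].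
have [|S [[Sw S0] Smax]] := @Zorn_bigcup V P.
  move=> F FP Ftot; split; first by move=> [X /FP[Xw _] /Xw].
  have [[X FX [x Xx]]|noX] := pselect (exists2 X, F X & X !=set0); last first.
    left; apply/seteqP; split=> // x [X FX Xx]; apply: noX.
    by exists X => //; exists x.
  have sub Y y : F Y -> Y y -> subspace Y.
    by move=> /FP[_ [->//|]].
  right; split; first by exists X => //; exact: (sub X x _ _).1.
  move=> c y z [Y FY Yy] [Z FZ Zz].
  have [YZ|ZY] := Ftot Y Z FY FZ.
    by exists Z => //; apply: (sub Z z _ _).2 => //; exact: YZ.
  by exists Y => //; apply: (sub Y y _ _).2 => //; exact: ZY.
have sS : subspace S.
  case: S0 Smax => // -> Smax; exfalso; apply: (Smax [set 0]).
    by split=> // /(_ 0); apply.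
  split; first by move=> /= w0'; move: w0; rewrite w0' eqxx.
  by right; split=> // c x y /= -> ->; rewrite scaler0 addr0.
have line v : exists c : k, S (v - c *: w).
  apply: contrapT => nv.
  pose T := [set x | exists2 c : k, S (x - c *: v) & True].
  have sT : subspace T.
    split=> [|c x y [a xa _] [b yb _]].
      by exists 0 => //; rewrite scale0r subr0; exact: sS.1.
    exists (c * a + b) => //; rewrite scalerDl -scalerA opprD addrACA -scalerBr.
    exact: sS.2.
  apply: (Smax T).
    split=> [x Sx|TS]; first by exists 0; rewrite // scale0r subr0.
    apply: nv; exists 0; rewrite scale0r subr0; apply: TS.
    by exists 1; rewrite // scale1r subrr; exact: sS.1.
  split; last by right.
  move=> [c wc _]; have [c0|c0] := eqVneq c 0.
    by apply: Sw; move: wc; rewrite c0 scale0r subr0.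
  apply: nv; exists c^-1; have := subspaceZ sS (- c^-1) wc.
  by rewrite scalerBr scalerA mulNr mulVf // scaleN1r opprK scaleNr addrC.
have line_uniq v c c' : S (v - c *: w) -> S (v - c' *: w) -> c = c'.
  move=> vc vc'; apply/eqP; rewrite -subr_eq0; apply: contrapT => /negP cc'.
  apply: Sw; have := subspaceZ sS (c - c')^-1 (subspaceB sS vc' vc).
  have -> : v - c' *: w - (v - c *: w) = (c - c') *: w.
    by rewrite opprB addrC addrA subrK scalerBl.
  by rewrite scalerA mulVf ?scale1r.
pose phi v := sval (cid (line v)).
have phiP v : S (v - phi v *: w) by rewrite /phi; case: cid.
exists phi.
  move=> c x y; apply: line_uniq (phiP _) _.
  rewrite scalerDl -scalerA opprD addrACA -scalerBr.
  by apply: sS.2; exact: phiP.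
by apply: line_uniq (phiP _) _; rewrite scale1r subrr; exact: sS.1.
Qed.

(** Adding a vector v not yet fixed by f g costs one coordinate: a functional equal to 1
on w = v - f (g v), evaluated at u - f (g u), vanishes on all vectors already
fixed. *)
Lemma finite_rank_retract (s : seq V) : exists r (g : V -> 'rV[k]_r) (f : 'rV[k]_r -> V),
  [/\ linear g, linear f & forall v, v \in s -> f (g v) = v].
Proof.
elim: s => [|v s [r [g [f [gl fl fg]]]]].
  exists 0%N, (fun=> 0), (fun=> 0).
  by split=> // [c x y|c x y]; rewrite scaler0 addr0.
set w := v - f (g v); have [w0|w0] := eqVneq w 0.
  exists r, g, f; split=> // u; rewrite inE => /orP[/eqP ->|]; last exact: fg.
  by apply/eqP; rewrite eq_sym -subr_eq0; apply/eqP.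
have [phi phil phiw] := separating_functional w0.
exists (r + 1)%N, (fun u => row_mx (g u) (phi (u - f (g u)))%:M),
  (fun x => f (lsubmx x) + rsubmx x 0 0 *: w); split.
- move=> c x y; rewrite scale_row_mx add_row_mx gl fl; congr row_mx.
  rewrite opprD addrACA -scalerBr phil scale_scalar_mx; apply/matrixP => i j.
  by rewrite !mxE -mulrnDl.
- move=> c x y; rewrite !linearP fl !mxE scalerDl -scalerA.
  by rewrite addrACA -scalerDr.
move=> u; rewrite row_mxKl row_mxKr !mxE eqxx mulr1n inE => /orP[/eqP ->|us].
  by rewrite -/w phiw scale1r addrC subrK.
by rewrite fg // subrr (lin0 phil) scale0r addr0.
Qed.

End Functionals.

Section Functoriality.
Variables (k : fieldType) (V W : lmodType k) (h : V -> W).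
Hypothesis hl : linear h.

Definition pL_map : pL V -> pL W := free_lift (fun v => pL_gen (h v)) (of_void (pL W)).

Let map_gr := pre_Lie_graded (@pL_pre_Lie k W).
Let map_gen_lin : linear (fun v => pL_gen (h v)).
Proof. by move=> c v w; rewrite hl /pL_gen gen_linear. Qed.

Lemma pL_map_morphism : alg_morphism pL_map.
Proof. exact: (free_lift_morphism map_gr map_gen_lin). Qed.

Lemma pL_map_gen v : pL_map (pL_gen v) = pL_gen (h v).
Proof. exact: (free_liftE map_gr map_gen_lin). Qed.

Lemma pL_map_Lie_elements x : Lie_elements V x -> Lie_elements W (pL_map x).
Proof.
have [pl pm] := pL_map_morphism; have [sL cL] := Lie_elements_subalgebra W.
suff : Lie_elements V `<=` [set x | Lie_elements W (pL_map x)] by apply.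
apply: smallest_sub => [|_ [v _ <-]]; last first.
  by rewrite /= pL_map_gen; exact: Lie_elements_gen.
split=> [|a b /= La Lb]; last by rewrite /commutator (linB pl) !pm; exact: cL.
split=> [|c a b /= La Lb]; first by rewrite /= (lin0 pl); exact: sL.1.
by rewrite /= pl; exact: sL.2.
Qed.

Definition pullback (M : rmodule (pL W)) : rmodule (pL V).
Proof.
exists (rmod_sort M) (fun m a => ract m (pL_map a)).
- by move=> a; exact: ract_linl.
- by move=> m c a b; rewrite pL_map_morphism.1 (ract_linr m).
- by move=> m a b; rewrite ractP /commutator (linB pL_map_morphism.1) !pL_map_morphism.2.
Defined.

End Functoriality.

Lemma pL_map_action_determined (k : fieldType) (V W : lmodType k) (g : V -> W) x :
  linear g -> action_determined x -> action_determined (pL_map g x).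
Proof.
move=> gl xdet M m p [pl pm] pg; have [hl hm] := pL_map_morphism gl.
apply: (xdet (pullback gl M) m (p \o pL_map g)).
  by split=> [c a b|a b] /=; rewrite ?hl ?pl // hm pm.
by move=> v /=; rewrite pL_map_gen.
Qed.

Fixpoint gens (k : fieldType) (V : lmodType k) (e : expr V void) : seq V :=
  match e with
  | Gen v => [:: v]
  | Add a b | Mul a b => gens a ++ gens b
  | Scale _ a => gens a
  | _ => [::]
  end.

Lemma pL_map_retract (k : fieldType) (V W : lmodType k) (g : V -> W) (f : W -> V) e :
  linear g -> linear f -> (forall v, v \in gens e -> f (g v) = v) ->
  pL_map f (pL_map g (cls e)) = cls e.
Proof.
move=> gl fl; have [pl pm] := pL_map_morphism gl; have [ql qm] := pL_map_morphism fl.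
elim: e => [|a IHa b IHb|c a IHa|v|[]|a IHa b IHb] /= fg.
- by rewrite cls0 (lin0 pl) (lin0 ql).
- rewrite clsD (linD pl) (linD ql) IHa ?IHb // => v ve; apply: fg;
    by rewrite mem_cat ve ?orbT.
- by rewrite clsZ (linZ pl) (linZ ql) IHa.
- by rewrite -[cls _]/(pL_gen v) !pL_map_gen // fg // inE.
- rewrite clsM pm qm IHa ?IHb // => v ve; apply: fg;
    by rewrite mem_cat ve ?orbT.
Qed.

Lemma kernel_Lie_elements (k : fieldType) (V : lmodType k) (x : pL V) :
  [pchar k] =i pred0 -> rpL_d (embed x) = 0 -> Lie_elements V x.
Proof.
move=> hk dx; have [e xe] : exists e, x = cls e by elim/cls_ind: x {dx} => e; exists e.
have [r [g [f [gl fl fg]]]] := finite_rank_retract (gens e).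
have <- : pL_map f (pL_map g x) = x by rewrite xe; exact: pL_map_retract.
apply: (pL_map_Lie_elements fl); set y := pL_map g x.
have ydet : action_determined y.
  exact: pL_map_action_determined gl (kernel_action_determined dx).
pose phi (i : 'I_r) (v : 'rV[k]_r) : k := v 0 i.
have phil i : linear (phi i : 'rV[k]_r -> k^o) by move=> c u v; rewrite /phi !mxE.
have [sL _] := Lie_elements_subalgebra 'rV[k]_r.
apply: (euler_descent hk sL (@Lie_elements_euler _ _)).
apply: left_normed_Lie_euler => //.
have [n yn] : exists n, weight_le n y.
  by elim/cls_ind: (y) => e'; exists (weight e'); exists e'.
apply: (@expansion_left_normed _ _ _ (fun i => delta_mx 0 i) _ phil _ _ _ _ yn).
- by move=> i j; rewrite /phi mxE eqxx.
- by move=> v; rewrite {1}(row_sum_delta v).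
by apply: expansion_kernel => // v; rewrite {1}(row_sum_delta v).
Qed.

Theorem theorem3p3 (k : fieldType) (V : lmodType k) (hk : [pchar k] =i pred0) :
  Lie_elements V = [set x : pL V | rpL_d (embed x) = 0].
Proof.
apply/seteqP; split=> x; first exact: Lie_elements_kernel.
exact: kernel_Lie_elements.
Qed.
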